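(* Fix a constant $\delta\in(0,\tfrac12)$ and let $L_n$ be any positive sequence diverging to infinity. Given data consisting of a simple graph on $n$ vertices, consider testing - $H_0$: the graph is drawn from $G(n,p)$ for some unknown $p\in(\delta,1-\delta)$; - $H_1$: the graph is drawn from $\mathsf{ERGM}(\beta_1,\beta_2)$ for some unknown $(\beta_1,\beta_2)\in\Lambda_{\mathsf{ERGM}}$, where $\beta_1\in\mathbb{R}$, $\beta_2\in\mathbb{R}^+$. 1. If $\Lambda_{\mathsf{ERGM}}=\{(\beta_1,\beta_2):\beta_2\ge L_n\frac{1}{\sqrt n},\ \beta_1\in\mathbb{R}\}$, then for some choice of $T_n=T_n(\delta,L_n)\to\infty$ the canonical test $\mathcal{T}(T_n,V)$, which depends only on $\delta$ and $L_n$, distinguishes $H_0$ and $H_1$ with high probability from a single sample. 2. If $\Lambda_{\mathsf{ERGM}}=\{(\beta_1,\beta_2):0\le\beta_2=\frac{1}{L_n\sqrt n},\ \beta_1\in\mathbb{R}\}$, then there is no statistical test which can distinguish $H_0$ and $H_1$ with high probability using a constant number of i.i.d. samples.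
   Context: $G(n,p)$ is the Erd\H{o}s-R\'enyi random graph. For a simple graph $x$ on $n$ labelled vertices, $E(x)$ is its number of edges and $V(x)$ is the number of (not necessarily induced) wedge subgraphs (paths with three vertices and two edges) in $x$. $\mathsf{ERGM}(\beta_1,\beta_2)$ is the exponential random graph model with Hamiltonian $\beta_1N_1(x)+\beta_2\frac{N_2(x)}{n}$, where $N_1$, $N_2$ count edge-preserving injective maps of the single edge, respectively the wedge, into $x$, so $N_1=2E$ and $N_2=2V$; that is, the probability measure on simple graphs on $n$ vertices given by $\nu(x)\propto\exp\big(2\beta_1E(x)+\frac{2\beta_2}{n}V(x)\big)$. A test (sequence) based on $k$ i.i.d. samples is a sequence of decision functions mapping $k$ graphs on $n$ vertices to $\{H_0,H_1\}$. Its risk is the supremum over all admissible parameters under $H_0$ and all admissible parameters under $H_1$ of the maximum of the two error probabilities (deciding $H_1$ under $H_0$, deciding $H_0$ under $H_1$). It distinguishes $H_0$ and $H_1$ with high probability if its risk tends to $0$ as $n\to\infty$. ''Constant number'' means $k$ is fixed independently of $n$. Canonical test: let $N=\binom n2$, $M_n=\{0,1,\dots,N\}$, and $S_n=M_n\cap[\frac\delta2N,(1-\frac\delta2)N]$. For $m\in M_n$ let $A_m$ be the set of simple graphs on $n$ vertices with exactly $m$ edges, and let $e_m(V)$ and $\sigma_m^2(V)$ be the mean and variance of $V(X)$ for $X$ uniform on $A_m$. The canonical test $\mathcal{T}(T,V)$ decides $H_1$ on input $X$ if $E(X)\notin S_n$, or if $E(X)\in S_n$ and $\frac{V(X)-e_{E(X)}(V)}{\sigma_{E(X)}(V)}\ge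 T$; otherwise it decides $H_0$. *)

(* Defs.v *)
From mathcomp Require Import all_boot.

Set Implicit Arguments.
Unset Strict Implicit.
Unset Printing Implicit Defensive.

(* A simple graph on the vertex set 'I_n is its set of edges, an edge being a
   set of two vertices. *)
Notation edge n := {e : {set 'I_n} | #|e| == 2}.
Notation graph n := {set edge n}.

Section Counts.
Variable n : nat.
Implicit Types x : graph n.

Definition nedges x : nat := #|x|.

(* Two distinct edges form a wedge iff together they cover three vertices. *)
Definition is_wedge (w : graph n) : bool :=
  (#|w| == 2) && (#|\bigcup_(e in w) val e| == 3).

Definition nwedges x : nat := #|[set w : graph n | (w \subset x) && is_wedge w]|.

Definition inj_homs k (H : graph k) x : nat :=
  #|[set f : {ffun 'I_k -> 'I_n} | injectiveb f &&
      [forall e in H, exists e' in x, val e' == f @: val e]]|.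
End Counts.

Definition edge_graph : graph 2 := setT.
Definition wedge_graph : graph 3 :=
  [set e : edge 3 | (inord 1 : 'I_3) \in val e].

(* N_1 and N_2 of the ERGM Hamiltonian. *)
Definition N1 n (x : graph n) : nat := inj_homs edge_graph x.
Definition N2 n (x : graph n) : nat := inj_homs wedge_graph x.

Section CountLemmas.
Variable n : nat.
Implicit Types x : graph n.

Let i0 : 'I_2 := ord0.
Let i1 : 'I_2 := ord_max.
Let j0 : 'I_3 := ord0.
Let j1 : 'I_3 := inord 1.
Let j2 : 'I_3 := ord_max.

Let ordI2 (i : 'I_2) : i = i0 \/ i = i1.
Proof. by case: i => [[|[|k]] H] //; [left|right]; apply: val_inj. Qed.

Let ordI3 (i : 'I_3) : [\/ i = j0, i = j1 | i = j2].
Proof.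
case: i => [[|[|[|k]]] H] //; [constructor 1|constructor 2|constructor 3];
  by apply: val_inj; rewrite /= ?inordK.
Qed.

Let j01 : j0 != j1. Proof. by rewrite -val_eqE /= inordK. Qed.
Let j12 : j1 != j2. Proof. by rewrite -val_eqE /= inordK. Qed.

Let inj2 (f : {ffun 'I_2 -> 'I_n}) : injectiveb f = (f i0 != f i1).
Proof.
apply/injectiveP/idP => [fi|/eqP nf i j]; first by apply/eqP => /fi.
by case: (ordI2 i) => ->; case: (ordI2 j) => ->; first [by []|by move/nf|by move/esym/nf].
Qed.

Let inj3 (f : {ffun 'I_3 -> 'I_n}) :
  injectiveb f = [&& f j0 != f j1, f j0 != f j2 & f j1 != f j2].
Proof.
apply/injectiveP/and3P => [fi|[/eqP a /eqP b /eqP c] i j].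
  by split; apply/eqP => /fi /eqP; rewrite ?(negPf j01) ?(negPf j12).
by case: (ordI3 i) => ->; case: (ordI3 j) => ->;
  first [by []|by move/a|by move/b|by move/c|by move/esym/a|by move/esym/b|by move/esym/c].
Qed.

Let set2_injr (a b c : 'I_n) : [set a; b] = [set a; c] -> b = c.
Proof.
move=> E; have hb := set22 a b; have := set22 a c; rewrite E in hb.
rewrite -E; move: hb; rewrite !inE => /orP [] /eqP -> //.
by rewrite orbb => /eqP.
Qed.

Let eff2 (a b : 'I_n) : {ffun 'I_2 -> 'I_n} := [ffun i : 'I_2 => if i == i0 then a else b].
Let eff3 (a b c : 'I_n) : {ffun 'I_3 -> 'I_n} :=
  [ffun i : 'I_3 => if i == j0 then a else if i == j1 then b else c].

Let eff30 a b c : eff3 a b c j0 = a. Proof. by rewrite ffunE eqxx. Qed.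
Let eff31 a b c : eff3 a b c j1 = b.
Proof. by rewrite ffunE eq_sym (negPf j01) eqxx. Qed.
Let eff32 a b c : eff3 a b c j2 = c.
Proof. by rewrite ffunE eq_sym (eq_sym j2) (negPf j12). Qed.
Let eff3K (f : {ffun 'I_3 -> 'I_n}) : f = eff3 (f j0) (f j1) (f j2).
Proof. by apply/ffunP => i; case: (ordI3 i) => ->; rewrite ?eff30 ?eff31 ?eff32. Qed.
Let eff2K (f : {ffun 'I_2 -> 'I_n}) : f = eff2 (f i0) (f i1).
Proof. by apply/ffunP => i; case: (ordI2 i) => ->; rewrite ffunE. Qed.

Let fibre2 (F W : finType) (S : {set F}) (D : {set W}) (r : F -> W -> bool) :
  (forall f, f \in S -> exists2 w, w \in D &
     forall w', w' \in D -> r f w' = (w' == w)) ->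
  (forall w, w \in D -> #|[set f in S | r f w]| = 2) -> #|S| = 2 * #|D|.
Proof.
move=> h1 h2; rewrite mulnC -sum_nat_const -sum1_card.
transitivity (\sum_(f in S) \sum_(w in D) r f w).
  apply: eq_bigr => f /h1 [w wD hw].
  rewrite (bigD1 w) //= hw // eqxx big1 // => w' /andP [w'D /negPf nw].
  by rewrite hw // nw.
rewrite exchange_big /=; apply: eq_bigr => w /h2 <-.
rewrite -big_mkcondr /= sum1_card; apply: eq_card => f.
by rewrite !inE.
Qed.

Let edge_inj (e e' : edge n) : val e = val e' -> e = e'.
Proof. exact: val_inj. Qed.

Lemma N1E x : N1 x = 2 * nedges x.
Proof.
rewrite /N1 /inj_homs /nedges.
pose T0 : edge 2 := exist _ setT (introT eqP (etrans (cardsT _) (card_ord 2))).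
have T0P (e : edge 2) : val e = setT.
  by apply/eqP; rewrite eqEcard subsetT cardsT card_ord (eqP (valP e)).
have im2 (f : {ffun 'I_2 -> 'I_n}) : f @: setT = [set f i0; f i1].
  apply/setP => u; rewrite !inE; apply/imsetP/orP => [[i _ ->]|].
    by case: (ordI2 i) => ->; [left|right].
  by case=> /eqP ->; [exists i0|exists i1].
set S := [set f | _].
apply: (fibre2 (r := fun (f : {ffun 'I_2 -> 'I_n}) (e : edge n) => val e == [set f i0; f i1])).
  move=> f; rewrite inE => /andP [_ /forall_inP/(_ T0 (in_setT _))/exists_inP].
  move=> [e ex]; rewrite im2 => /eqP ee; exists e => // e' _.
  by rewrite -ee val_eqE.
move=> e ex; have /cards2P [a [b [nab eab]]] := valP e.
suff -> : [set f in S | val e == [set f i0; f i1]] = [set eff2 a b; eff2 b a].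
  rewrite cards2; case: eqP => // /ffunP/(_ i0); rewrite !ffunE eqxx.
  by move/eqP: nab.
apply/setP => f; rewrite !inE inj2; apply/andP/orP.
  move=> [/andP [nf _]]; rewrite eab => /eqP E.
  have := set21 a b; rewrite {1}E !inE => /orP [] /eqP Ea.
    by left; rewrite [f]eff2K -Ea; apply/eqP; congr eff2; move: E; rewrite Ea => /set2_injr.
  right; rewrite [f]eff2K -Ea; apply/eqP; congr eff2.
  by move: E; rewrite Ea [RHS]setUC => /set2_injr.
have key u v : u != v -> [set a; b] = [set u; v] -> f = eff2 u v ->
  (f i0 != f i1) && [forall e0 in edge_graph,
     exists e' in x, \val e' == f @: \val e0] /\ \val e == [set f i0; f i1].
  move=> nuv E fE; have f0 : f i0 = u by rewrite fE ffunE eqxx.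
  have f1 : f i1 = v by rewrite fE ffunE.
  rewrite f0 f1 eab E eqxx nuv; split=> //=.
  apply/forall_inP => e0 _; apply/exists_inP; exists e => //.
  by rewrite T0P im2 f0 f1 eab E.
case=> /eqP; first exact: key.
by apply: key; rewrite 1?eq_sym // setUC.
Qed.

Let otherP k (e : edge k) v : v \in val e -> exists2 c, v != c & val e = [set v; c].
Proof.
have /cards2P [a [b [nab ->]]] := valP e; rewrite !inE => /orP [] /eqP ->.
  by exists b.
by exists a; rewrite 1?eq_sym // setUC.
Qed.

Lemma N2E x : N2 x = 2 * nwedges x.
Proof.
rewrite /N2 /inj_homs /nwedges.
have E01 : #|[set j1; j0]| == 2 by rewrite cards2 (eq_sym j1) j01.
have E12 : #|[set j1; j2]| == 2 by rewrite cards2 j12.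
pose T01 : edge 3 := exist (fun e : {set 'I_3} => #|e| == 2) _ E01.
pose T12 : edge 3 := exist (fun e : {set 'I_3} => #|e| == 2) _ E12.
have H01 : T01 \in wedge_graph by rewrite inE /= set21.
have H12 : T12 \in wedge_graph by rewrite inE /= set21.
have HP (e : edge 3) : e \in wedge_graph -> val e = [set j1; j0] \/ val e = [set j1; j2].
  rewrite inE => /otherP [c nc ->].
  by case: (ordI3 c) nc => ->; rewrite ?eqxx //; [left|right].
have im2 (f : {ffun 'I_3 -> 'I_n}) i j : f @: [set i; j] = [set f i; f j].
  by rewrite imsetU1 imset_set1.
set S := [set f | _].
have SP (f : {ffun 'I_3 -> 'I_n}) : reflect
    ([/\ f j0 != f j1, f j0 != f j2 & f j1 != f j2] /\
     exists e1 e2 : edge n, [/\ e1 \in x, e2 \in x, val e1 = [set f j1; f j0] &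
                       val e2 = [set f j1; f j2]]) (f \in S).
  rewrite inE inj3; apply: (iffP andP) => [[/and3P nf H]|[/and3P nf [e1 [e2 [x1 x2 v1 v2]]]]].
    split=> //; move/forall_inP: H => H.
    have /exists_inP [e1 x1 /eqP v1] := H _ H01.
    have /exists_inP [e2 x2 /eqP v2] := H _ H12.
    by exists e1, e2; split; rewrite // ?v1 ?v2 /= im2.
  split=> //; apply/forall_inP => e0 /HP [] ->; apply/exists_inP.
    by exists e1; rewrite // v1 im2.
  by exists e2; rewrite // v2 im2.
pose g (f : {ffun 'I_3 -> 'I_n}) : graph n :=
  [set e : edge n | (val e == [set f j1; f j0]) || (val e == [set f j1; f j2])].
have gE (f : {ffun 'I_3 -> 'I_n}) (e1 e2 : edge n) : val e1 = [set f j1; f j0] -> val e2 = [set f j1; f j2] ->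
    g f = [set e1; e2].
  by move=> v1 v2; apply/setP => e; rewrite !inE -v1 -v2 !val_eqE.
have cupE (e1 e2 : edge n) : e1 != e2 ->
    \bigcup_(e in [set e1; e2]) val e = val e1 :|: val e2.
  by move=> ne; rewrite big_setU1 ?inE //= big_set1.
apply: (fibre2 (r := fun (f : {ffun 'I_3 -> 'I_n}) (w : graph n) => w == g f)) => [f /SP [nf [e1 [e2 [x1 x2 v1 v2]]]]|w].
  exists (g f) => //; rewrite (gE _ _ _ v1 v2) inE.
  have ne : e1 != e2.
    apply/eqP => E; case: nf => _ /eqP nf _; apply: nf.
    by move: v1; rewrite E v2 => /set2_injr.
  rewrite /is_wedge cards2 ne cupE // v1 v2 subUset !sub1set x1 x2 /=.
  rewrite setUA [_ :|: [set f j1]]setUC setUA setUid -setUA.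
  case: nf => n01 n02 n12.
  by rewrite cardsU1 cards2 !inE n02 (eq_sym (f j1)) (negPf n01) (negPf n12).
rewrite inE => /and3P [wx /cards2P [e1 [e2 [ne wE]]]].
rewrite wE cupE // cardsU (eqP (valP e1)) (eqP (valP e2)) => /eqP c3.
have c1 : #|val e1 :&: val e2| == 1.
  have := subset_leq_card (subsetIl (val e1) (val e2)); rewrite (eqP (valP e1)).
  by move: c3; case: #|_| => [|[|[|]]].
have [c cE] := cards1P c1.
have : c \in val e1 :&: val e2 by rewrite cE set11.
rewrite inE => /andP [/otherP [a nca v1] /otherP [b ncb v2]].
have nab : a != b.
  by apply: contra_neq ne => E; apply: edge_inj; rewrite v1 v2 E.
have x1 : e1 \in x by apply: (subsetP wx); rewrite wE set21.
have x2 : e2 \in x by apply: (subsetP wx); rewrite wE set22.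
suff -> : [set f in S | [set e1; e2] == g f] = [set eff3 a c b; eff3 b c a].
  rewrite cards2; case: eqP => // /ffunP/(_ j0); rewrite !eff30.
  by move/eqP: nab.
apply/setP => f; rewrite in_set2 inE; apply/andP/orP.
  move=> [_ /eqP gf].
  have : e1 \in g f by rewrite -gf set21.
  have : e2 \in g f by rewrite -gf set22.
  rewrite !inE => h2 h1.
  have f1c : f j1 = c.
    apply/set1P; rewrite -cE inE.
    by case/orP: h1 => /eqP ->; case/orP: h2 => /eqP ->; rewrite !set21.
  move: h1 h2; rewrite v1 v2 f1c.
  case/orP => /eqP /set2_injr ha; case/orP => /eqP /set2_injr hb.
  - by move: nab; rewrite ha hb eqxx.
  - by left; rewrite [f]eff3K f1c ha hb.
  - by right; rewrite [f]eff3K f1c ha hb.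
  - by move: nab; rewrite ha hb eqxx.
case=> /eqP ->.
  split.
    apply/SP; rewrite eff30 eff31 eff32 (eq_sym a c) nca nab ncb.
    by split=> //; exists e1, e2.
  by apply/eqP; rewrite (gE _ e1 e2) // eff31 ?eff30 ?eff32.
split.
  apply/SP; rewrite eff30 eff31 eff32 (eq_sym b c) nca (eq_sym b a) nab ncb.
  by split=> //; exists e2, e1.
by apply/eqP; rewrite (gE _ e2 e1) ?eff31 ?eff30 ?eff32 // setUC.
Qed.
End CountLemmas.

Definition npairs (n : nat) : nat := 'C(n, 2).

(* A_m *)
Definition graphs_with n (m : nat) : {set graph n} :=
  [set x : graph n | nedges x == m].

From mathcomp Require Import all_order all_algebra.
From mathcomp Require Import all_classical all_reals all_analysis.

Import Order.TTheory GRing.Theory Num.Theory.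
Import numFieldNormedType.Exports.

Local Open Scope classical_set_scope.
Local Open Scope ring_scope.

Section Models.
Variable R : realType.

Definition gnp n (p : R) (x : graph n) : R :=
  p ^+ nedges x * (1 - p) ^+ (npairs n - nedges x).

Definition hamiltonian n (b1 b2 : R) (x : graph n) : R :=
  b1 * (N1 x)%:R + b2 * ((N2 x)%:R / n%:R).

Lemma hamiltonianE n (b1 b2 : R) (x : graph n) :
  hamiltonian b1 b2 x =
  2 * b1 * (nedges x)%:R + 2 * b2 / n%:R * (nwedges x)%:R.
Proof.
rewrite /hamiltonian N1E N2E !natrM; congr (_ + _); first by rewrite mulrCA mulrA.
by rewrite -!mulrA mulrCA [_%:R * n%:R^-1]mulrC.
Qed.

Definition ergm n (b1 b2 : R) (x : graph n) : R :=
  expR (hamiltonian b1 b2 x) / \sum_(y : graph n) expR (hamiltonian b1 b2 y).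

(* Probability that k i.i.d. samples from the mass function mu satisfy A. *)
Definition iid_prob k n (mu : graph n -> R) (A : pred (k.-tuple (graph n))) : R :=
  \sum_(X : k.-tuple (graph n) | A X) \prod_(i < k) mu (tnth X i).

(* A decision is a boolean: true stands for H_1 and false for H_0. *)
Definition test (k : nat) := forall n : nat, k.-tuple (graph n) -> bool.

Definition H0_params (delta : R) : set R := [set p | delta < p < 1 - delta].

Definition worst_error k n (phi : k.-tuple (graph n) -> bool)
    (p : R) (b : R * R) : R :=
  Num.max (iid_prob (@gnp n p) [pred X | phi X])
          (iid_prob (@ergm n b.1 b.2) [pred X | ~~ phi X]).

(* For 0 < delta < 1/2 and nonempty Lambda this real supremum is taken over a
   nonempty set of numbers in [0, 1]. *)
Definition risk k n (delta : R) (Lambda : set (R * R))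
    (phi : k.-tuple (graph n) -> bool) : R :=
  sup [set worst_error phi p b | p in H0_params delta & b in Lambda].

Definition distinguishes k (delta : R) (Lambda : nat -> set (R * R))
    (phi : test k) : Prop :=
  risk delta (Lambda n) (@phi n) @[n --> \oo] --> (0 : R).

(* The admissible (beta_1, beta_2) for graphs on n vertices. *)
Definition Lambda_strong (L : nat -> R) (n : nat) : set (R * R) :=
  [set b | 0 <= b.2 /\ L n * (1 / Num.sqrt n%:R) <= b.2].

(* The second range is a curve in beta_2: equality, not an upper bound. *)
Definition Lambda_weak (L : nat -> R) (n : nat) : set (R * R) :=
  [set b | 0 <= b.2 /\ b.2 = 1 / (L n * Num.sqrt n%:R)].

(* Mean and standard deviation of V(X), for X uniform over A_m. *)
Definition meanV n (m : nat) : R :=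
  (\sum_(x in graphs_with n m) (nwedges x)%:R) / #|graphs_with n m|%:R.

Definition varV n (m : nat) : R :=
  (\sum_(x in graphs_with n m) ((nwedges x)%:R - meanV n m) ^+ 2)
    / #|graphs_with n m|%:R.

Definition sigmaV n (m : nat) : R := Num.sqrt (varV n m).

Definition Sset (delta : R) (n m : nat) : bool :=
  (m <= npairs n)%N &&
  (delta / 2 * (npairs n)%:R <= m%:R <= (1 - delta / 2) * (npairs n)%:R).

(* If sigma = 0 the quotient is 0 by convention; for edge counts in S_n this can
   only happen when n is small. *)
Definition canonical_decision (delta T : R) n (x : graph n) : bool :=
  ~~ Sset delta n (nedges x) ||
  (T <= ((nwedges x)%:R - meanV n (nedges x)) / sigmaV n (nedges x)).

Definition canonical_test (delta : R) (T : nat -> R) : test 1 :=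
  fun n X => canonical_decision delta (T n) (thead X).
End Models.

(* Main.v *)
Require Import Defs.
From mathcomp Require Import all_boot all_order all_algebra.
From mathcomp Require Import all_classical all_reals all_analysis.
From mathcomp Require Import perm zify ring lra.
Import Order.TTheory GRing.Theory Num.Theory.
Import numFieldNormedType.Exports.
Local Open Scope classical_set_scope.
Local Open Scope ring_scope.

(** Given the number [m] of edges, both models are explicit: [G(n,p)] is uniform on
the graphs with [m] edges, and the exponential random graph is that uniform law
tilted by [exp (theta V)] with [theta = 2 beta_2 / n]. The standard deviation of
[V] on such a class is of order [n^(3/2)], so the tilt matters exactly when
[beta_2 sqrt n] does.

Strong interaction. Under [G(n,p)] the two rejection events are handled by
Chebyshev's inequality, for the edge count ([gnp_edges_tail]) and, on each edge
class, for the wedge count ([slice_chebyshev]). Under the exponential model it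
suffices that the uniform law on an edge class has large exponential moments,
[E exp (kappa (V - E V)) >= exp (c lam^2)] for [kappa = lam / n^(3/2)] and
[lam <= sqrt n]: tilting by any [theta >= kappa] then puts almost no mass below
[E V + T sigma] when [T] is a small multiple of [lam] ([tilted_lower_tail]), because
[sigma] is at most [3 n^(3/2)] ([varV_le]). The lower bound ([wedge_mgf_ge]) uses a
symmetry of the edge class instead of a limit theorem. Take
vertices [a_i], [b_i] and [u_j], with [i] and [j] ranging over [n / 3] values, and for
every pair [(i, j)] independently decide by a fair coin whether to exchange the
potential edges [a_i u_j] and [b_i u_j]. This keeps the number of edges and the
degree of every [u_j], and it splits the edges of row [i] randomly between [a_i] and
[b_i]. As [2 V] is the sum of the squared degrees minus twice the number of edges,
[V] becomes a constant plus independent centred squares of sign sums, one for each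
row, whose exponential moments are bounded below directly; Jensen's inequality
removes the remaining randomness of the graph. The bound on the variance rests on
the exchangeability of the edges together with the fact that the centred edge
indicators add up to zero ([slice_exch]).

Weak interaction. Choose [p = 1/2], and choose [beta_1] so that the Hamiltonian is,
up to a constant, a multiple [t] of the quadratic form summing the products of the
signs of adjacent edges. The second moment of the likelihood ratio is then
[E exp (t W) E exp (- t W)], and decoupling ([chaos_mgf]) bounds it by [e] as soon as
[L_n >= 6]. By the Cauchy-Schwarz inequality on [k]-tuples ([iid_prob_sqr_le]) the two
errors of a test cannot both tend to zero. *)

Set Implicit Arguments.
Unset Strict Implicit.
Unset Printing Implicit Defensive.

(** * Elementary bounds on the exponential *)

Section Cosh.
Variable R : realType.
Implicit Types u x y : R.

Definition cosh u : R := (expR u + expR (- u)) / 2.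

Lemma coshN u : cosh (- u) = cosh u.
Proof. by rewrite /cosh opprK addrC. Qed.

Lemma cosh_norm u : cosh `|u| = cosh u.
Proof. by case: (ler0P u) => _ //; rewrite coshN. Qed.

(** From [cosh u = 1 + (e^(u/2) - e^(-u/2))^2 / 2] and [e^(u/2) - e^(-u/2) >= u/2]
for [u >= 0], which gives 1/8 instead of the optimal 1/2. *)
Lemma cosh_ge u : 1 + u ^+ 2 / 8 <= cosh u.
Proof.
rewrite -cosh_norm -real_normK ?num_real //.
have := normr_ge0 u; move: `|u| => {}u u0.
have h1 := expR_ge1Dx (u / 2).
have h2 : expR (- (u / 2)) <= 1 by rewrite expR_le1; lra.
have e1 : expR (u / 2) * expR (- (u / 2)) = 1 by exact: expRxMexpNx_1.
have -> : cosh u = ((expR (u/2)) ^+ 2 + expR (- (u/2)) ^+ 2) / 2.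
  by rewrite /cosh !expr2 -!expRD; congr ((expR _ + expR _) / 2); field.
have h3 := expR_gt0 (- (u / 2)).
nra.
Qed.

Lemma cosh_ge1 u : 1 <= cosh u.
Proof. by apply: le_trans (cosh_ge u); nra. Qed.

Lemma expR_le_inv x : x < 1 -> expR x <= (1 - x)^-1.
Proof.
move=> x1; have := expR_ge1Dx (- x); rewrite expRN => h.
rewrite -[expR x]invrK lef_pV2 ?posrE ?invr_gt0 ?expR_gt0 //; lra.
Qed.

Lemma expR_ge_inv x : 0 <= x <= 1 / 4 -> (1 - x)^-1 <= expR (2 * x).
Proof.
move=> /andP [x0 x1]; have h := expR_ge1Dx (2 * x).
by rewrite -div1r ler_pdivrMr; nra.
Qed.

(** For [|u| >= 1/2] already [e^|u| <= e^(2 u^2)]; for smaller [u] average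
[e^u <= 1/(1-u)] and [e^(-u) <= 1/(1+u)] to get [1/(1-u^2)]. *)
Lemma cosh_le u : cosh u <= expR (2 * u ^+ 2).
Proof.
rewrite -cosh_norm -real_normK ?num_real //.
have := normr_ge0 u; move: `|u| => {}u u0.
have [h|h] := leP (1 / 2) u.
  have a : expR u <= expR (2 * u ^+ 2) by rewrite ler_expR; nra.
  have b : expR (- u) <= expR u by rewrite ler_expR; lra.
  rewrite /cosh; lra.
have a : expR u <= (1 - u)^-1 by apply: expR_le_inv; lra.
have b : expR (- u) <= (1 + u)^-1.
  by have := @expR_le_inv (- u); rewrite opprK; apply; lra.
have e : ((1 - u)^-1 + (1 + u)^-1) / 2 = (1 - u ^+ 2)^-1.
  by field; rewrite !gt_eqF //; nra.
have c : (1 - u ^+ 2)^-1 <= expR (2 * u ^+ 2) by apply: expR_ge_inv; nra.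
rewrite /cosh; lra.
Qed.

Lemma expR_half_le x : 0 <= x <= 1 -> expR (x / 2) <= 1 + x.
Proof.
move=> /andP [x0 x1]; apply: le_trans (expR_le_inv _) _; first by lra.
by rewrite -div1r ler_pdivrMr; nra.
Qed.

End Cosh.

(** * Averages over independent signs *)

Section Signs.
Variables (R : realType) (T : finType).
Implicit Types (x y z S : {set T}) (e f j : T) (l : seq T).

(** A subset of [T] encodes a point of the discrete cube, a member carrying the
sign -1; sums over [{set T}] divided by [ncube] are then Rademacher averages,
and symmetric difference is the product of signs. *)
Definition sgn x e : R := (-1) ^+ (e \in x).
Definition symd x y : {set T} := [set e | (e \in x) (+) (e \in y)]%SET.
Definition ncube : R := #|{set T}|%:R.

Lemma ncube_gt0 : 0 < ncube.
Proof. by rewrite ltr0n; apply/card_gt0P; exists finset.set0. Qed.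

Lemma ncubeE : ncube = 2 ^+ #|T|.
Proof.
rewrite /ncube -natrX; congr (_%:R); rewrite -[in RHS]cardsT -card_powerset.
by apply: eq_card => x; rewrite !inE finset.subsetT.
Qed.

Lemma sum_cst (c : R) : \sum_(x : {set T}) c = c * ncube.
Proof. by rewrite sumr_const mulr_natr; congr (_ *+ _); apply: eq_card. Qed.

Lemma symdK y : cancel (symd^~ y) (symd^~ y).
Proof. by move=> x; apply/setP => e; rewrite !inE -addbA addbb addbF. Qed.

Lemma symdC x y : symd x y = symd y x.
Proof. by apply/setP => e; rewrite !inE addbC. Qed.

Lemma sum_symd y (F : {set T} -> R) : \sum_x F (symd x y) = \sum_x F x.
Proof. by rewrite [RHS](reindex_inj (can_inj (symdK y))). Qed.

Lemma sgn_symd x y e : sgn (symd x y) e = sgn x e * sgn y e.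
Proof. by rewrite /sgn inE signr_addb. Qed.

Lemma sgn_sqr x e : sgn x e ^+ 2 = 1.
Proof. by rewrite /sgn sqrr_sign. Qed.

Lemma sgn1 j e : sgn (finset.set1 j) e = if e == j then -1 else 1.
Proof. by rewrite /sgn inE; case: eqP. Qed.

Lemma sum_flip y (F : {set T} -> R) :
  \sum_x F x = \sum_x (F x + F (symd x y)) / 2.
Proof. by rewrite -mulr_suml big_split /= sum_symd; field. Qed.

(** Averaging over the sign at [j] alone; this is the induction step for every
estimate on a weighted sum of independent signs. *)
Lemma peel_sign j l (r : T -> R) (F : R -> R) : j \notin l ->
  \sum_x F (\sum_(i <- j :: l) sgn x i * r i) =
  \sum_x (F (\sum_(i <- l) sgn x i * r i + r j)
          + F (\sum_(i <- l) sgn x i * r i - r j)) / 2.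
Proof.
move=> jl; rewrite (sum_flip (finset.set1 j)); apply: eq_bigr => x _.
rewrite !big_cons sgn_symd sgn1 eqxx.
have -> : \sum_(i <- l) sgn (symd x (finset.set1 j)) i * r i =
          \sum_(i <- l) sgn x i * r i.
  apply: eq_big_seq => i il; rewrite sgn_symd sgn1.
  by case: eqP => [ij|_]; [rewrite -ij il in jl|rewrite mulr1].
rewrite [_ * r j + _]addrC [_ * -1 * r j + _]addrC /sgn.
by case: (j \in x); rewrite ?expr1 ?expr0 ?mul1r ?mulr1 ?mulN1r ?mulrN1 ?opprK ?mul1r // [X in X / _]addrC.
Qed.

Lemma sum_expR_sgn (c : T -> R) :
  \sum_z expR (\sum_e sgn z e * c e) = ncube * \prod_e cosh (c e).
Proof.
rewrite ncubeE -prodr_const -big_split /=.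
under [RHS]eq_bigr => e _ do rewrite /cosh [2 * _]mulrC divfK // addrC.
rewrite bigA_distr; apply: eq_bigr => z _.
rewrite expR_sum; apply: eq_bigr => e _.
by rewrite /sgn; case: (e \in z); rewrite ?expr1 ?expr0 ?mul1r ?mulN1r.
Qed.

Lemma exp_square_step (s b r : R) :
  (expR (s * (b + r) ^+ 2) + expR (s * (b - r) ^+ 2)) / 2 =
  expR (s * r ^+ 2) * (expR (s * b ^+ 2) * cosh (2 * s * b * r)).
Proof.
rewrite /cosh mulrA mulrA -expRD mulrDr -!expRD.
by congr ((expR _ + expR _) / 2); ring.
Qed.

(** Averaging out one sign replaces [s] by [s (1 + 8 s)] and costs a factor
[e^s]; as long as [16 s k <= 1] the accumulated growth of [s] at most doubles
the exponent [s k]. *)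
Lemma rad_square_mgf_le l (s : R) : uniq l -> 0 <= s -> 16 * s * (size l)%:R <= 1 ->
  \sum_x expR (s * (\sum_(i <- l) sgn x i) ^+ 2) <= expR (2 * s * (size l)%:R) * ncube.
Proof.
elim: l s => [|j l IH] s /=.
  move=> _ _ _; rewrite mulr0 expR0 -sum_cst; apply: ler_sum => x _.
  by rewrite big_nil expr0n mulr0 expR0.
move=> /andP [jl ul] s0; rewrite -natr1 => hs.
have k0 : 0 <= (size l)%:R :> R by [].
set k := (size l)%:R in hs k0 *.
pose s' := s * (1 + 8 * s).
have hs' : s' * k <= s * k + s / 2 by rewrite /s'; nra.
have := IH s' ul; rewrite -/k => /(_ _ _)-IHs.
have {IHs} : \sum_x expR (s' * (\sum_(i <- l) sgn x i) ^+ 2) <= expR (2 * s' * k) * ncube.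
  by apply: IHs; rewrite /s' in hs' *; nra.
move=> IHs.
under eq_bigr => x _ do under eq_bigr => i _ do rewrite -[sgn x i]mulr1.
rewrite (peel_sign (fun=> 1) (fun b => expR (s * b ^+ 2))) //.
apply: le_trans (_ : expR s * \sum_x expR (s' * (\sum_(i <- l) sgn x i) ^+ 2) <= _).
  rewrite mulr_sumr; apply: ler_sum => x _.
  under eq_bigr => i _ do rewrite mulr1.
  set b := \sum_(i <- l) _.
  rewrite exp_square_step expr1n !mulr1 ler_pM2l ?expR_gt0 //.
  apply: le_trans (_ : expR (s * b ^+ 2) * expR (2 * (2 * s * b) ^+ 2) <= _).
    by rewrite ler_pM2l ?expR_gt0 // cosh_le.
  by rewrite -expRD ler_expR /s'; lra.
apply: le_trans (_ : expR s * (expR (2 * s' * k) * ncube) <= _).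
  by rewrite ler_pM2l ?expR_gt0.
rewrite mulrA -expRD ler_pM2r ?ncube_gt0 // ler_expR; lra.
Qed.

Lemma rad_square_mean l (r : T -> R) : uniq l ->
  \sum_x (\sum_(i <- l) sgn x i * r i) ^+ 2 = (\sum_(i <- l) r i ^+ 2) * ncube.
Proof.
elim: l => [|j l IH] /=.
  by move=> _; rewrite !big_nil mul0r big1 // => x _; rewrite big_nil expr0n.
move=> /andP [jl ul]; rewrite (peel_sign _ (fun b => b ^+ 2)) //.
rewrite big_cons mulrDl -IH // addrC -sum_cst -big_split /=.
by apply: eq_bigr => x _; field.
Qed.

(** The centred square [B^2 - h] of a sign sum is non-degenerate with variance of
order [h^2 - h]. Averaging out the sign at [j] adds at least
[s^2 r_j^2 E(b^2 e^(...)) / 2] to the moment generating function, and there the exponential is bounded below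
using [b^2 >= 0], so that only [E b^2] is needed. *)
Lemma rad_square_mgf_ge l (r : T -> R) (s : R) : uniq l ->
  (forall j, r j ^+ 2 = 0 \/ r j ^+ 2 = 1) -> 0 <= s -> s * (size l)%:R <= 1 / 2 ->
  let h := \sum_(i <- l) r i ^+ 2 in
  [/\ 0 <= h, h <= (size l)%:R, h <= h ^+ 2 & (1 + s ^+ 2 * (h ^+ 2 - h) / 8) * ncube <=
  \sum_x expR (s * ((\sum_(i <- l) sgn x i * r i) ^+ 2 - h))].
Proof.
move=> ul r01 s0; elim: l ul => [|j l IH] /=.
  move=> _ _; rewrite !big_nil; split=> //.
  rewrite -sum_cst; apply: ler_sum => x _.
  by rewrite big_nil !(expr0n, subrr, mulr0, mul0r, addr0, expR0).
move=> /andP [jl ul]; rewrite -natr1 => hs.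
have [|h0 hl hh IHs] := IH ul; first by lra.
move: h0 hl hh IHs; rewrite big_cons.
set h := \sum_(i <- l) _; set k := (size l)%:R in hs *.
move=> h0 hl hh IHs.
have sh : s * h <= 1 / 2 by nra.
split; [by case: (r01 j) => ->; lra|by case: (r01 j) => ->; lra|by case: (r01 j) => ->; nra|].
rewrite (peel_sign _ (fun b => expR (s * (b ^+ 2 - (r j ^+ 2 + h))))) //.
(* here b^2 - h >= - h, so s h <= 1/2 keeps the exponential away from 0 *)
have eh : 1 / 2 <= expR (- (s * h)) by apply: le_trans (expR_ge1Dx _); lra.
apply: le_trans (_ : \sum_x (expR (s * ((\sum_(i <- l) sgn x i * r i) ^+ 2 - h)) +
    s ^+ 2 * r j ^+ 2 / 4 * (\sum_(i <- l) sgn x i * r i) ^+ 2) <= _).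
  rewrite big_split /= -mulr_sumr rad_square_mean // -/h.
  have c0 := ncube_gt0.
  apply: le_trans (lerD IHs (lexx _)).
  rewrite mulrA -mulrDl ler_pM2r //.
  case: (r01 j) => ->; nra.
apply: ler_sum => x _; set b := \sum_(i <- l) _.
have -> : (expR (s * ((b + r j) ^+ 2 - (r j ^+ 2 + h))) +
   expR (s * ((b - r j) ^+ 2 - (r j ^+ 2 + h)))) / 2 =
   expR (s * (b ^+ 2 - h)) * cosh (2 * s * b * r j).
  by rewrite /cosh mulrA [expR _ * (_ + _)]mulrDr -!expRD; congr ((expR _ + expR _) / 2); ring.
have hc := cosh_ge (2 * s * b * r j).
have e1 : 1 / 2 <= expR (s * (b ^+ 2 - h)).
  by apply: le_trans eh _; rewrite ler_expR; have := sqr_ge0 b; nra.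
apply: le_trans (_ : expR (s * (b ^+ 2 - h)) * (1 + (2 * s * b * r j) ^+ 2 / 8) <= _);
  last by rewrite ler_pM2l ?expR_gt0.
have : 0 <= (s * b * r j) ^+ 2 by exact: sqr_ge0.
nra.
Qed.

End Signs.

(** * Exponential moments of quadratic forms in signs *)

Lemma jensen_expR (R : realType) (I : finType) (A : {set I}) (y : I -> R) :
  (0 < #|A|)%N ->
  #|A|%:R * expR ((\sum_(i in A) y i) / #|A|%:R) <= \sum_(i in A) expR (y i).
Proof.
move=> A0; have A0' : #|A|%:R != 0 :> R by rewrite pnatr_eq0 -lt0n.
set m := (\sum_(i in A) y i) / _.
have -> : #|A|%:R * expR m = \sum_(i in A) (expR m * (1 + (y i - m))).
  rewrite -mulr_sumr big_split /= sumr_const sumrB sumr_const.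
  by rewrite -[m *+ _]mulr_natr /m divfK // subrr addr0 mulrC.
apply: ler_sum => i _.
have -> : expR (y i) = expR m * expR (y i - m) by rewrite -expRD addrC subrK.
by rewrite ler_pM2l ?expR_gt0 // expR_ge1Dx.
Qed.

Section Chaos.
Variables (R : realType) (T : finType) (r : rel T) (d : nat).
Hypotheses (rsym : symmetric r) (rirr : irreflexive r).
Hypothesis rdeg : forall e, (#|[set f | r e f]%SET| <= d)%N.
Implicit Types (x y z S : {set T}) (e f : T) (t : R).
Local Notation sg := (@sgn R T).
Local Notation cT := (@ncube R T).
Local Notation adj e f := ((r e f)%:R : R).

(** Each unordered pair of adjacent elements is counted twice. *)
Definition chaos x : R := \sum_e \sum_f adj e f * (sg x e * sg x f).

(** The linear form multiplying the sign at [e] once the signs in [S] and outside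
[S] have been decoupled. *)
Let outer S x e : R := \sum_f adj e f * (f \notin S)%:R * sg x f.

Lemma sum_chaos : \sum_x chaos x = 0.
Proof.
rewrite exchange_big big1 //= => e _; rewrite exchange_big big1 //= => f _.
rewrite (sum_flip (finset.set1 e)) big1 // => x _; rewrite !sgn_symd !sgn1 eqxx.
case: eqP => [->|_]; first by rewrite rirr !mul0r addr0 mul0r.
by rewrite mulr1 mulrN1 mulNr mulrN subrr mul0r.
Qed.

(** Flipping the signs in [S] changes exactly the products with one index in [S]
and one outside. *)
Lemma chaos_symd S x :
  chaos x - chaos (symd x S) = \sum_e sg x e * (4 * (e \in S)%:R * outer S x e).
Proof.
pose w (P Q : bool) e f : R := adj e f * (sg x e * sg x f) * (P && Q)%:R.
transitivity (\sum_e \sum_f (2 * w (e \in S) (f \notin S) e f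
                             + 2 * w (f \in S) (e \notin S) f e)).
  rewrite /chaos -sumrB; apply: eq_bigr => e _; rewrite -sumrB; apply: eq_bigr => f _.
  rewrite !sgn_symd /w (rsym f e) /sgn.
  by case: (e \in S); case: (f \in S); rewrite /= ?expr0 ?expr1; ring.
under eq_bigr => e _ do rewrite big_split /=.
rewrite big_split /= [X in _ + X]exchange_big /= -big_split /=.
apply: eq_bigr => e _; rewrite -big_split /= /outer !mulr_sumr; apply: eq_bigr => f _.
rewrite /w -mulnb natrM; ring.
Qed.

(** The coefficients depend only on the signs outside [S], so the signs inside
[S] may be resampled independently; they contribute a product of [cosh]. *)
Lemma decouple_sign S (c : {set T} -> T -> R) :
  (forall x e, e \notin S -> c x e = 0) ->
  (forall x z e, c (symd x (z :&: S)%SET) e = c x e) ->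
  \sum_x expR (\sum_e sg x e * c x e) <= \sum_x expR (\sum_e 2 * c x e ^+ 2).
Proof.
move=> c0 cS; rewrite -(ler_pM2l (@ncube_gt0 R T)).
have -> : cT * \sum_x expR (\sum_e sg x e * c x e) =
   \sum_x \sum_z expR (\sum_e sg z e * (sg x e * c x e)).
  rewrite exchange_big /= mulrC -sum_cst; apply: eq_bigr => z _.
  rewrite -(sum_symd (z :&: S)%SET); apply: eq_bigr => x _; congr expR.
  apply: eq_bigr => e _; rewrite cS sgn_symd.
  have [eS|eS] := boolP (e \in S); last by rewrite c0 // !mulr0.
  by rewrite {2}/sgn inE eS andbT /sgn; ring.
rewrite mulr_sumr; apply: ler_sum => x _.
rewrite sum_expR_sgn ler_pM2l ?ncube_gt0 // expR_sum.
apply: ler_prod => e _; apply/andP; split.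
  by apply: le_trans (cosh_ge1 _); exact: ler01.
by apply: le_trans (cosh_le _) _; rewrite exprMn sgn_sqr mul1r.
Qed.

(** Decoupling. Since the form has mean zero, Jensen lets us subtract it at an
independent point, written as a random sign flip [S] of [x]; the difference is
linear in the signs inside [S]. Integrating these out leaves
[exp (32 t^2 sum_e A_e^2)] with [A_e] a sum of at most [d] signs. Convexity reduces
this to a single [e], at the price of the factor [#|T|] in the exponent. *)
Lemma chaos_mgf t : (0 < #|T|)%N -> 512 * t ^+ 2 * #|T|%:R * d%:R <= 1 ->
  \sum_x expR (t * chaos x) <= expR (1 / 2) * cT.
Proof.
move=> T0 ht; set N : R := #|T|%:R in ht *.
have N0 : 0 < N by rewrite ltr0n.
have d0 : 0 <= d%:R :> R by [].
have c0 := @ncube_gt0 R T.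
rewrite -(ler_pM2l c0).
(* e^(t chaos x) is at most the average over S of e^(t (chaos x - chaos (x symd S))) *)
apply: le_trans (_ : \sum_x \sum_S expR (t * (chaos x - chaos (symd x S))) <= _).
  rewrite mulr_sumr; apply: ler_sum => x _.
  under eq_bigr => S _ do rewrite symdC.
  rewrite (sum_symd x (fun y => expR (t * (chaos x - chaos y)))).
  apply: le_trans (_ : \sum_y expR (t * chaos x) * (1 - t * chaos y) <= _); last first.
    apply: ler_sum => y _; rewrite [t * (_ - _)]mulrBr expRD ler_pM2l ?expR_gt0 //; exact: expR_ge1Dx.
  rewrite -mulr_sumr sumrB sum_cst -mulr_sumr sum_chaos mulr0 subr0 mul1r.
  by rewrite mulrC.
rewrite exchange_big /= [leRHS](_ : _ = \sum_(S : {set T}) expR (1 / 2) * cT); last first.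
  by rewrite sum_cst mulrC.
apply: ler_sum => S _.
pose c x e : R := t * (4 * (e \in S)%:R * outer S x e).
apply: le_trans (_ : \sum_x expR (\sum_e sg x e * c x e) <= _).
  rewrite le_eqVlt; apply/orP; left; apply/eqP; apply: eq_bigr => x _; congr expR.
  by rewrite chaos_symd mulr_sumr; apply: eq_bigr => e _; rewrite /c; ring.
apply: le_trans (decouple_sign (S := S) _ _) _.
- by move=> x e /negPf eS; rewrite /c eS mulr0 mul0r mulr0.
- move=> x z e; rewrite /c; congr (_ * (_ * _)); apply: eq_bigr => f _.
  rewrite sgn_symd {2}/sgn inE; case: (f \in S); rewrite ?mulr0 ?mul0r //.
  by rewrite andbF expr0 !mulr1.
apply: le_trans (_ : \sum_x N^-1 * \sum_e expR (32 * t ^+ 2 * N * outer S x e ^+ 2) <= _).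
  apply: ler_sum => x _; rewrite -(ler_pM2l N0) mulVKf ?gt_eqF //.
  have := @jensen_expR R T (finset.setT) (fun e => 32 * t ^+ 2 * N * outer S x e ^+ 2).
  rewrite cardsT => /(_ T0).
  rewrite (eq_bigl predT); last by move=> e; rewrite inE.
  rewrite [X in _ <= X -> _](eq_bigl predT); last by move=> e; rewrite inE.
  apply: le_trans; rewrite -/N ler_pM2l // ler_expR mulr_suml.
  apply: ler_sum => e _; rewrite [leRHS]mulrAC [leRHS](_ : _ = 32 * t ^+ 2 * outer S x e ^+ 2).
    rewrite /c; have := mulr_ge0 (sqr_ge0 t) (sqr_ge0 (outer S x e)).
    by case: (e \in S); rewrite ?mulr0 ?mulr1 ?mul0r; nra.
  by field; rewrite gt_eqF.
rewrite -mulr_sumr exchange_big /= mulrC ler_pdivrMr //.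
rewrite [leRHS](_ : _ = \sum_(e : T) expR (1 / 2) * cT); last first.
  by rewrite sumr_const mulr_natr.
apply: ler_sum => e _.
pose l := enum [set f | r e f && (f \notin S)]%SET.
have szl : (size l <= d)%N.
  rewrite -cardE; apply: leq_trans (rdeg e); apply: subset_leq_card.
  by apply/fintype.subsetP => f; rewrite !inE => /andP [].
have szl' : (size l)%:R <= d%:R :> R by rewrite ler_nat.
have s0 : 0 <= 32 * t ^+ 2 * N.
  by apply: mulr_ge0; [apply: mulr_ge0; rewrite ?sqr_ge0|exact: ltW].
have oE x : outer S x e = \sum_(f <- l) sg x f.
  rewrite big_enum_cond /= /outer [RHS](eq_bigl (fun f => r e f && (f \notin S))); last first.
    by move=> f; rewrite inE andbT.
  rewrite [RHS]big_mkcond; apply: eq_bigr => f _.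
  by case: (r e f); case: (f \in S); rewrite /= ?mul1r ?mul0r.
under eq_bigr => x _ do rewrite oE.
have hd : 16 * (32 * t ^+ 2 * N) * d%:R <= 1 by lra.
set s := 32 * t ^+ 2 * N in s0 hd *.
have hs : 16 * s * (size l)%:R <= 1 by nra.
apply: le_trans (rad_square_mgf_le (enum_uniq _) s0 hs) _.
by rewrite ler_pM2r // ler_expR; lra.
Qed.

End Chaos.

(** * Wedges as pairs of adjacent edges *)

Section LineGraph.
Variable n : nat.
Implicit Types (e f : edge n) (x : graph n) (v : 'I_n).

(** Wedges are the edges of the line graph of the complete graph. *)
Definition ladj e f : bool := #|(val e :&: val f)%SET| == 1%N.
Definition vdeg x v : nat := (\sum_(e in x) (v \in val e))%N.

Lemma card_val_edge e : #|val e| = 2%N.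
Proof. exact/eqP/(valP e). Qed.

Lemma card_edges : #|{: edge n}| = npairs n.
Proof.
rewrite card_sig /npairs -[in RHS](card_ord n) -card_draws.
by rewrite cardsE; apply: eq_card => A; rewrite !inE.
Qed.

Lemma ladj_sym : symmetric ladj.
Proof. by move=> e f; rewrite /ladj finset.setIC. Qed.

Lemma ladj_irr : irreflexive ladj.
Proof. by move=> e; rewrite /ladj finset.setIid card_val_edge. Qed.

Lemma card_edgeI e f : #|(val e :&: val f)%SET| = (2 * (e == f) + ladj e f)%N.
Proof.
have [->|nef] := eqVneq e f; first by rewrite ladj_irr finset.setIid card_val_edge.
have : (#|(val e :&: val f)%SET| <= 2)%N.
  by rewrite -[leqRHS](card_val_edge e) subset_leq_card // finset.subsetIl.
rewrite /ladj; case E : #|_| => [|[|[|k]]] // _.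
case/eqP: nef; apply: val_inj; apply/eqP.
have a : (val e :&: val f)%SET = val e.
  by apply/eqP; rewrite eqEcard finset.subsetIl card_val_edge E.
have b : (val e :&: val f)%SET = val f.
  by apply/eqP; rewrite eqEcard finset.subsetIr card_val_edge E.
by rewrite -{1}a b.
Qed.

Lemma star_card v : (\sum_(f : edge n) (v \in val f) = n.-1)%N.
Proof.
have -> : (\sum_(f : edge n) (v \in val f) = #|{: edge n}| - #|[set f : edge n | v \notin val f]%SET|)%N.
  rewrite -sum1_card -sum1_card [X in (X - _)%N](bigID (fun f : edge n => v \in val f)) /=.
  rewrite [X in (_ - X)%N](eq_bigl (fun f : edge n => v \notin val f)); last by move=> f; rewrite inE.
  by rewrite addnK [RHS]big_mkcond; apply: eq_bigr => f _; case: (v \in val f).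
have -> : #|[set f : edge n | v \notin val f]%SET| = 'C(n.-1, 2).
  have -> : n.-1 = #|(~: [set v])%SET| by rewrite cardsC1 card_ord.
  rewrite -cards_draws -(card_imset _ val_inj); apply: eq_card => A; rewrite !inE.
  apply/imsetP/andP => [[f]|[sA cA]].
    by rewrite inE => nf ->; rewrite (valP f) finset.subsetC finset.sub1set inE.
  exists (exist (fun e : {set 'I_n} => #|e| == 2) A cA) => //.
  by rewrite inE /=; move: sA; rewrite finset.subsetC finset.sub1set inE.
rewrite card_edges /npairs; case: n v => [[]//|k] _.
by rewrite binS bin1 addKn.
Qed.

Lemma sum_cardI e (P : pred (edge n)) :
  (\sum_(f | P f) #|(val e :&: val f)%SET| =
   \sum_(v in val e) \sum_(f | P f) (v \in val f))%N.
Proof.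
rewrite exchange_big /=; apply: eq_bigr => f _.
rewrite -sum1_card big_mkcond [RHS]big_mkcond; apply: eq_bigr => v _.
by rewrite inE; case: (v \in val e); case: (v \in val f).
Qed.

(** Double counting of incidences: the two ends of [e] lie on [n - 1] edges each,
and [e] itself is counted twice. *)
Lemma ladj_deg e : (\sum_f ladj e f = 2 * (n - 2))%N.
Proof.
have := sum_cardI e predT.
under eq_bigr => f _ do rewrite card_edgeI.
rewrite big_split /= -big_distrr /= (bigD1 e) //= eqxx big1; last first.
  by move=> f /negPf; rewrite eq_sym => ->.
under [in RHS]eq_bigr => v _ do rewrite star_card.
have n2 : (2 <= n)%N by rewrite -[leqLHS](card_val_edge e) -[leqRHS]card_ord max_card.
rewrite sum_nat_const card_val_edge; set D := (\sum_(_ | _) _)%N; lia.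
Qed.

Lemma card_ladj e : #|[set f | ladj e f]%SET| = (2 * (n - 2))%N.
Proof.
rewrite -(ladj_deg e) -sum1_card big_mkcond; apply: eq_bigr => f _.
by rewrite inE; case: (ladj e f).
Qed.

Lemma wedge_pair e f : e != f -> is_wedge [set e; f]%SET = ladj e f.
Proof.
move=> nef; rewrite /is_wedge cards2 nef /= big_setU1 ?inE //= big_set1.
rewrite cardsU !card_val_edge /ladj.
have := card_edgeI e f; rewrite (negPf nef) /ladj; move: #|_| => k.
by case: k => [|[|k]].
Qed.

Lemma nwedges_ladj x : (2 * nwedges x = \sum_(e in x) \sum_(f in x) ladj e f)%N.
Proof.
pose P (p : edge n * edge n) := [&& p.1 \in x, p.2 \in x & ladj p.1 p.2].
transitivity (\sum_(p | P p) 1)%N; last first.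
  rewrite pair_big_dep /= [RHS](bigID (fun p => ladj p.1 p.2)) /=.
  rewrite [X in (_ + X)%N]big1; last by move=> p /andP [_ /negPf ->].
  rewrite addn0; apply: eq_big => [p|p /and3P [_ _ ->] //].
  by rewrite /P andbA.
rewrite (partition_big (fun p => [set p.1; p.2]%SET)
  (mem [set w : graph n | (w \subset x) && is_wedge w]%SET)) /=; last first.
  move=> [e f] /and3P [/= ex fx ef]; rewrite inE wedge_pair ?ef; last first.
    by apply: contraTneq ef => ->; rewrite ladj_irr.
  by rewrite andbT finset.subUset !finset.sub1set ex fx.
rewrite /nwedges -sum1_card big_distrr /=; apply: eq_bigr => w.
rewrite inE => /andP [wx ww]; rewrite muln1.
have /cards2P [e [f [nef wE]]] : #|w| == 2 by case/andP: ww.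
move: wx ww; rewrite wE finset.subUset !finset.sub1set wedge_pair // => /andP [ex fx] ef.
rewrite sum1_card; transitivity #|[set (e, f); (f, e)]%SET|.
  by rewrite cards2 xpair_eqE negb_and nef.
apply: eq_card => -[a b]; rewrite [RHS]unfold_in !inE /P /= !xpair_eqE; apply/idP/idP.
  case/orP => /andP [/eqP -> /eqP ->]; first by rewrite ex fx ef eqxx.
  by rewrite ex fx ladj_sym ef finset.setUC eqxx.
move=> /andP [/and3P [_ _ ab] /eqP E].
have nab : a != b by apply: contraTneq ab => ->; rewrite ladj_irr.
have := set21 a b; have := set22 a b; rewrite E !inE.
case/orP => /eqP Eb; case/orP => /eqP Ea; rewrite Ea Eb ?eqxx ?orbT //.
  by rewrite Ea Eb eqxx in nab.
by rewrite Ea Eb eqxx in nab.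
Qed.

(** Both sides count the ordered pairs of edges of [x], possibly equal, with a marked
common vertex. *)
Lemma sum_vdeg_sqr x : (\sum_v vdeg x v ^ 2 = 2 * nedges x + 2 * nwedges x)%N.
Proof.
transitivity (\sum_(e in x) \sum_(f in x) #|(val e :&: val f)%SET|)%N.
  under [RHS]eq_bigr => e _ do rewrite sum_cardI.
  transitivity (\sum_(e in x) \sum_v (v \in val e) * vdeg x v)%N; last first.
    apply: eq_bigr => e _; rewrite [RHS]big_mkcond; apply: eq_bigr => v _.
    by case: (v \in val e); rewrite ?mul1n ?mul0n.
  rewrite exchange_big; apply: eq_bigr => v _.
  by rewrite -big_distrl /= expnS expn1.
rewrite nwedges_ladj /nedges mulnC -sum_nat_const -big_split; apply: eq_bigr => e ex /=.
under eq_bigr => f _ do rewrite card_edgeI.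
rewrite big_split /= -big_distrr /= (bigD1 e) //= eqxx big1 // => f /andP [_ /negPf].
by rewrite eq_sym => ->.
Qed.

End LineGraph.

(** * Moments under the uniform law on sets of fixed size *)

Lemma sum_delta (R : realType) (T : finType) (e : T) (F : T -> R) :
  \sum_g (g == e)%:R * F g = F e.
Proof.
rewrite (bigD1 e) //= eqxx mul1r big1 ?addr0 // => g /negPf ->.
by rewrite mul0r.
Qed.

Section Slice.
Variables (R : realType) (T : finType) (m : nat).
Hypotheses (mN : (m <= #|T|)%N) (T0 : (0 < #|T|)%N).
Implicit Types (x y D : {set T}) (a b c e f g h : T).

Definition slice : {set {set T}} := [set x : {set T} | #|x| == m]%SET.
Local Notation A := slice.
Local Notation cA := (#|A|%:R).
Local Notation N := (#|T|%:R).
Definition dens : R := m%:R / N.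
Local Notation p := dens.
(** Centring at the density makes the sum over all [e] vanish identically on the
slice, which is what drives all moment estimates below. *)
Definition eta x e : R := (e \in x)%:R - p.

Lemma card_slice_gt0 : (0 < #|A|)%N.
Proof. by rewrite card_draws bin_gt0. Qed.

Let N0 : 0 < N :> R. Proof. by rewrite ltr0n. Qed.

Lemma dens01 : 0 <= p <= 1.
Proof. by rewrite divr_ge0 //= ler_pdivrMr // mul1r ler_nat. Qed.

Lemma sum_slice_preim (phi : T -> T) (F : {set T} -> R) : involutive phi ->
  \sum_(x in A) F (phi @^-1: x)%SET = \sum_(x in A) F x.
Proof.
move=> phiK; have hK : involutive (fun x => phi @^-1: x)%SET.
  by move=> x; apply/setP => e; rewrite !inE phiK.
rewrite [RHS](reindex_inj (can_inj hK)); apply: eq_bigl => x.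
rewrite !inE on_card_preimset //.
by exists phi => e _; rewrite phiK.
Qed.

Lemma sum_eta x : x \in A -> \sum_e eta x e = 0.
Proof.
rewrite inE => /eqP xm; rewrite sumrB sumr_const.
have -> : \sum_e (e \in x)%:R = m%:R :> R.
  by rewrite -xm -sum1_card natr_sum [RHS]big_mkcond; apply: eq_bigr => e _; case: (e \in x).
by rewrite -[p *+ _]mulr_natr divfK ?subrr // gt_eqF.
Qed.

(** Multiply [sum_e eta x e = 0] by [P x] and average: by exchangeability every
index outside [D] contributes equally. So an index that occurs only once in a mixed
moment can be eliminated, with the gain of a factor of order [1 / #|T|]. *)
Lemma slice_exch D (P : {set T} -> R) c :
  (forall x y, {in D, forall e, (e \in x) = (e \in y)} -> P x = P y) -> c \notin D ->
  (N - #|D|%:R) * \sum_(x in A) P x * eta x c =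
  - \sum_(e in D) \sum_(x in A) P x * eta x e.
Proof.
move=> PD cD; apply/eqP; rewrite -addr_eq0; apply/eqP.
transitivity (\sum_(x in A) P x * \sum_e eta x e); last first.
  by apply: big1 => x xA; rewrite sum_eta // mulr0.
under [RHS]eq_bigr => x _ do rewrite mulr_sumr.
rewrite [RHS]exchange_big [RHS](bigID (mem D)) /= addrC; congr (_ + _).
rewrite [RHS](eq_bigr (fun=> \sum_(x in A) P x * eta x c)).
  rewrite sumr_const -[RHS]mulr_natl; congr (_ * _).
  by rewrite -(cardC (mem D)) natrD addrC addKr.
move=> g gD; rewrite -(@sum_slice_preim (tperm c g)); last exact: tpermK.
apply: eq_bigr => x _; congr (_ * _); last by rewrite /eta inE tpermR.
apply: PD => e eD; rewrite inE tpermD //.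
  by apply: contraNneq cD => ->.
by apply: contraNneq gD => ->.
Qed.

Lemma eta_dep D e : e \in D -> forall x y,
  {in D, forall e, (e \in x) = (e \in y)} -> eta x e = eta y e.
Proof. by move=> eD x y xy; rewrite /eta xy. Qed.

Lemma eta_norm x e : `|eta x e| <= 1.
Proof.
have /andP [p0 p1] := dens01.
by rewrite /eta ler_norml; case: (e \in x) => /=; apply/andP; split; lra.
Qed.

Lemma mean_eta e : \sum_(x in A) eta x e = 0.
Proof.
have := @slice_exch finset.set0 (fun=> 1) e; rewrite cards0 subr0 big_set0 oppr0.
rewrite inE => /(_ (fun _ _ _ => erefl) isT) /eqP.
rewrite mulf_eq0 gt_eqF //= => /eqP E; rewrite -[RHS]E.
by apply: eq_bigr => x _; rewrite mul1r.
Qed.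

Lemma mean_eta_sqr e : \sum_(x in A) eta x e ^+ 2 = p * (1 - p) * cA.
Proof.
transitivity (\sum_(x in A) ((1 - 2 * p) * eta x e + p * (1 - p))).
  by apply: eq_bigr => x _; rewrite /eta; case: (e \in x) => /=; ring.
by rewrite big_split /= -mulr_sumr mean_eta mulr0 add0r sumr_const mulr_natr.
Qed.

Lemma mean_eta2 a b : a != b ->
  (N - 1) * \sum_(x in A) eta x a * eta x b = - (p * (1 - p) * cA).
Proof.
move=> ab; have := @slice_exch (finset.set1 a) (eta ^~ a) b.
rewrite cards1 inE eq_sym (negPf ab) => -> //.
  by rewrite big_set1 -(mean_eta_sqr a).
by move=> x y; apply: eta_dep; rewrite inE.
Qed.

Lemma sum_slice_le (F : {set T} -> R) : (forall x, `|F x| <= 1) ->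
  `|\sum_(x in A) F x| <= cA.
Proof.
move=> F1; apply: le_trans (ler_norm_sum _ _ _) _.
by rewrite -sumr_const; apply: ler_sum.
Qed.

Hypothesis N6 : (6 <= #|T|)%N.
Let N6' : 6 <= N :> R. Proof. by rewrite (ler_nat _ 6). Qed.

Lemma eta_prod_norm (s : seq T) x : `|\prod_(e <- s) eta x e| <= 1.
Proof.
elim: s => [|e s IH]; first by rewrite big_nil normr1.
by rewrite big_cons normrM mulr_ile1 ?eta_norm.
Qed.

Lemma mom3 a b c : uniq [:: a; b; c] ->
  `|\sum_(x in A) eta x a ^+ 2 * eta x b * eta x c| <= 3 / N * cA.
Proof.
rewrite /= !inE negb_or -andbA => /and4P [ab ac bc _].
have := @slice_exch [set a; b]%SET (fun x => eta x a ^+ 2 * eta x b) c.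
rewrite cards2 ab !inE negb_or (eq_sym c a) ac (eq_sym c b) bc => /(_ _ isT) E.

have {}E : (N - 2) * \sum_(x in A) eta x a ^+ 2 * eta x b * eta x c =
    - \sum_(e in [set a; b]%SET) \sum_(x in A) eta x a ^+ 2 * eta x b * eta x e.
  by apply: E => x y xy; rewrite !(eta_dep _ xy) ?inE ?eqxx ?orbT.
move: E; rewrite big_setU1 ?inE //= big_set1 => E.
have h1 : `|\sum_(x in A) eta x a ^+ 2 * eta x b * eta x a| <= cA.
  apply: sum_slice_le => x; have := eta_prod_norm [:: a; a; b; a] x.
  by rewrite !big_cons big_nil mulr1 expr2 !mulrA.
have h2 : `|\sum_(x in A) eta x a ^+ 2 * eta x b * eta x b| <= cA.
  apply: sum_slice_le => x; have := eta_prod_norm [:: a; a; b; b] x.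
  by rewrite !big_cons big_nil mulr1 expr2 !mulrA.
move: h1 h2 E; set S1 := \sum_(x in A) _; set S2 := \sum_(x in A) _.
set S3 := \sum_(x in A) _ => h1 h2 E.
have h3 : (N - 2) * `|S3| <= 2 * cA.
  have h6 := N6'.
  rewrite -[X in X * _]ger0_norm; last by lra.
  rewrite -normrM E normrN; apply: le_trans (ler_normD _ _) _; lra.
rewrite mulrAC ler_pdivlMr //.
have := N6'; have := normr_ge0 S3; have : 0 <= cA :> R by []. nra.
Qed.

Lemma mom4 a b c e : uniq [:: a; b; c; e] ->
  `|\sum_(x in A) eta x a * eta x b * eta x c * eta x e| <= 18 / N ^+ 2 * cA.
Proof.
rewrite /= !inE !negb_or -!andbA => /and5P [ab ac ae bc /and3P [be ce _]].
have := @slice_exch [set a; b; c]%SET (fun x => eta x a * eta x b * eta x c) e.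
have E3 : #|[set a; b; c]%SET| = 3%N.
  by rewrite finset.setUC cardsU1 cards2 ab !inE negb_or (eq_sym c a) ac (eq_sym c b) bc.
rewrite E3 !inE !negb_or (eq_sym e a) ae (eq_sym e b) be (eq_sym e c) ce => /(_ _ isT) E.
have {}E : (N - 3) * \sum_(x in A) eta x a * eta x b * eta x c * eta x e =
    - \sum_(g in [set a; b; c]%SET) \sum_(x in A) eta x a * eta x b * eta x c * eta x g.
  by apply: E => x y xy; rewrite !(eta_dep _ xy) ?inE ?eqxx ?orbT.
move: E; rewrite finset.setUC big_setU1 ?inE ?negb_or ?(eq_sym c a) ?ac ?(eq_sym c b) ?bc //=.
rewrite big_setU1 ?inE //= big_set1 => E.
have h1 : `|\sum_(x in A) eta x a * eta x b * eta x c * eta x c| <= 3 / N * cA.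
  rewrite (eq_bigr (fun x => eta x c ^+ 2 * eta x a * eta x b)); last by move=> x _; ring.
  by apply: mom3; rewrite /= !inE !negb_or (eq_sym c a) ac (eq_sym c b) bc ab.
have h2 : `|\sum_(x in A) eta x a * eta x b * eta x c * eta x a| <= 3 / N * cA.
  rewrite (eq_bigr (fun x => eta x a ^+ 2 * eta x b * eta x c)); last by move=> x _; ring.
  by apply: mom3; rewrite /= !inE !negb_or ab ac bc.
have h3 : `|\sum_(x in A) eta x a * eta x b * eta x c * eta x b| <= 3 / N * cA.
  rewrite (eq_bigr (fun x => eta x b ^+ 2 * eta x a * eta x c)); last by move=> x _; ring.
  by apply: mom3; rewrite /= !inE !negb_or (eq_sym b a) ab ac bc.
move: h1 h2 h3 E; set S1 := \sum_(x in A) _; set S2 := \sum_(x in A) _.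
set S3 := \sum_(x in A) _; set S4 := \sum_(x in A) _ => h1 h2 h3 E.
have h4 : (N - 3) * `|S4| <= 3 * (3 / N * cA).
  have h6 := N6'.
  rewrite -[X in X * _]ger0_norm; last by lra.
  rewrite -normrM E normrN; apply: le_trans (ler_normD _ _) _.
  have := ler_normD S2 S3; lra.
have -> : 18 / N ^+ 2 * cA = 18 / N * cA / N :> R by field; rewrite gt_eqF.
rewrite ler_pdivlMr //.
have := N6'; have := normr_ge0 S4; have : 0 <= 3 / N * cA :> R by rewrite mulr_ge0 // divr_ge0.
have -> : 18 / N * cA = 6 * (3 / N * cA) :> R by field; rewrite gt_eqF.
set q := 3 / N * cA in h4 *. nra.
Qed.

(** Upper bounds for the normalised moment of [eta_e eta_f eta_g eta_h] according to
whether the pairs coincide, share one index, or are disjoint. *)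
Definition pattern e f g h : R :=
  (g == e)%:R * (h == f)%:R + (g == f)%:R * (h == e)%:R
  + 3 / N * ((g == e)%:R + (g == f)%:R + (h == e)%:R + (h == f)%:R) + 18 / N ^+ 2.

Lemma mom_pattern e f g h : e != f -> g != h ->
  \sum_(x in A) (eta x e * eta x f) * (eta x g * eta x h) <= pattern e f g h * cA.
Proof.
move=> ef gh; apply: le_trans (ler_norm _) _.
have cA0 : 0 <= cA :> R by [].
have n1 : 0 <= 3 / N :> R by rewrite divr_ge0.
have n2 : 0 <= 18 / N ^+ 2 :> R by rewrite divr_ge0 // exprn_ge0.
have crude : `|\sum_(x in A) (eta x e * eta x f) * (eta x g * eta x h)| <= cA.
  apply: sum_slice_le => x; have := eta_prod_norm [:: e; f; g; h] x.
  by rewrite !big_cons big_nil mulr1 !mulrA.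
have m3 a b c : uniq [:: a; b; c] ->
    (forall x, (eta x e * eta x f) * (eta x g * eta x h) = eta x a ^+ 2 * eta x b * eta x c) ->
    `|\sum_(x in A) (eta x e * eta x f) * (eta x g * eta x h)| <= 3 / N * cA.
  by move=> u E; rewrite (eq_bigr _ (fun x _ => E x)); apply: mom3.
rewrite /pattern; set S := `|_| in crude m3 *.
set n3 := 3 / N in n1 m3 *; have := n2; set n18 := 18 / N ^+ 2 => n2'.
have q3 : 0 <= n3 * cA by apply: mulr_ge0.
have q18 : 0 <= n18 * cA by apply: mulr_ge0.
have [ge|ge] := eqVneq g e.
  have [hf|hf] := eqVneq h f; first by case: (g == f); case: (h == e) => /=; lra.
  have hS : S <= n3 * cA.
    apply: (m3 e f h); last by move=> x; rewrite ge; ring.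
    by rewrite /= !inE !negb_or ef -{1}ge gh eq_sym hf.
  case: (g == f); case: (h == e) => /=; lra.
have [gf|gf] := eqVneq g f.
  have [he|he] := eqVneq h e; first by case: (h == f) => /=; lra.
  have hS : S <= n3 * cA.
    apply: (m3 f e h); last by move=> x; rewrite gf; ring.
    by rewrite /= !inE !negb_or (eq_sym f e) ef -{1}gf gh eq_sym he.
  case: (h == e); case: (h == f) => /=; lra.
have [he|he] := eqVneq h e.
  have hS : S <= n3 * cA.
    apply: (m3 e f g); last by move=> x; rewrite he; ring.
    by rewrite /= !inE !negb_or ef (eq_sym e g) ge (eq_sym f g) gf.
  case: (h == f) => /=; lra.
have [hf|hf] := eqVneq h f.
  have hS : S <= n3 * cA.
    apply: (m3 f e g); last by move=> x; rewrite hf; ring.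
    by rewrite /= !inE !negb_or (eq_sym f e) ef (eq_sym e g) ge (eq_sym f g) gf.
  rewrite /=; lra.
have hS : S <= n18 * cA.
  rewrite /S (eq_bigr (fun x => eta x e * eta x f * eta x g * eta x h)); last by move=> x _; ring.
  apply: mom4.
  by rewrite /= !inE !negb_or ef (eq_sym e g) ge (eq_sym e h) he (eq_sym f g) gf (eq_sym f h) hf gh.
rewrite /=; lra.
Qed.

Variables (r : rel T) (d : nat).
Hypotheses (rsym : symmetric r) (rirr : irreflexive r).
Hypothesis rdeg : forall e, (\sum_f r e f = d)%N.
Local Notation adj e f := ((r e f)%:R).

Definition qform x : R := \sum_e \sum_f adj e f * (eta x e * eta x f).

Lemma sum_adj e : \sum_f adj e f = d%:R :> R.
Proof. by rewrite -natr_sum rdeg. Qed.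

Lemma sum_pattern e f : \sum_g \sum_h adj g h * pattern e f g h <= 2 + 30 * d%:R / N.
Proof.
pose dl g e : R := (g == e)%:R.
have adj1 a b : adj a b <= 1 :> R by case: (r a b).
have sumE a : \sum_g \sum_h adj g h * dl g a = d%:R.
  rewrite -(sum_adj a) -(sum_delta a (fun g => \sum_h adj g h)).
  by apply: eq_bigr => g _; rewrite -mulr_suml mulrC.
have sumE' a : \sum_g \sum_h adj g h * dl h a = d%:R.
  rewrite exchange_big /= -[RHS](sumE a); apply: eq_bigr => g _; apply: eq_bigr => h _.
  by rewrite rsym.
have sum2 a b : \sum_g \sum_h adj g h * (dl g a * dl h b) = adj a b.
  rewrite -(sum_delta a (fun g => adj g b)); apply: eq_bigr => g _.
  rewrite -(sum_delta b (fun h => adj g h)) mulr_sumr; apply: eq_bigr => h _.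
  by rewrite /dl; ring.
have sum0 : \sum_g \sum_h adj g h = N * d%:R :> R.
  by under eq_bigr => g _ do rewrite sum_adj; rewrite sumr_const mulr_natl.
have -> : \sum_g \sum_h adj g h * pattern e f g h =
  \sum_g \sum_h adj g h * (dl g e * dl h f) + \sum_g \sum_h adj g h * (dl g f * dl h e)
  + 3 / N * (\sum_g \sum_h adj g h * dl g e + \sum_g \sum_h adj g h * dl g f +
     \sum_g \sum_h adj g h * dl h e + \sum_g \sum_h adj g h * dl h f)
  + 18 / N ^+ 2 * \sum_g \sum_h adj g h.
  rewrite -!big_split /= !mulr_sumr -!big_split /=; apply: eq_bigr => g _.
  rewrite -!big_split /= !mulr_sumr -!big_split /=; apply: eq_bigr => h _.
  by rewrite /pattern /dl; ring.
rewrite !sum2 !sumE !sumE' sum0.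
have -> : 18 / N ^+ 2 * (N * d%:R) = 18 * d%:R / N :> R by field; rewrite gt_eqF.
have -> : 3 / N * (d%:R + d%:R + d%:R + d%:R) = 12 * d%:R / N :> R by field; rewrite gt_eqF.
have := adj1 e f; have := adj1 f e; lra.
Qed.

(** The three patterns occur at most [2 N d], [4 N d^2] and [(N d)^2] times, so each
of the last two contributes at most a constant times [d^2]. *)
Lemma qform_sqr : \sum_(x in A) qform x ^+ 2 <= N * d%:R * (2 + 30 * d%:R / N) * cA.
Proof.
have -> : \sum_(x in A) qform x ^+ 2 = \sum_e \sum_f adj e f * \sum_g \sum_h adj g h *
    \sum_(x in A) (eta x e * eta x f) * (eta x g * eta x h).
  transitivity (\sum_(x in A) \sum_e \sum_f \sum_g \sum_h
     adj e f * (adj g h * ((eta x e * eta x f) * (eta x g * eta x h)))).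
    apply: eq_bigr => x _; rewrite expr2 {1}/qform mulr_suml; apply: eq_bigr => e _.
    rewrite mulr_suml; apply: eq_bigr => f _; rewrite /qform mulr_sumr; apply: eq_bigr => g _.
    by rewrite mulr_sumr; apply: eq_bigr => h _; ring.
  rewrite exchange_big; apply: eq_bigr => e _; rewrite exchange_big; apply: eq_bigr => f _ /=.
  rewrite mulr_sumr exchange_big; apply: eq_bigr => g _ /=.
  rewrite mulr_sumr exchange_big; apply: eq_bigr => h _ /=.
  by rewrite !mulr_sumr.
apply: le_trans (_ : \sum_e \sum_f adj e f * ((2 + 30 * d%:R / N) * cA) <= _); last first.
  under eq_bigr => e _ do rewrite -mulr_suml sum_adj.
  by rewrite sumr_const -mulr_natl le_eqVlt; apply/orP; left; apply/eqP; ring.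
apply: ler_sum => e _; apply: ler_sum => f _.
have [ref|_] := boolP (r e f); last by rewrite !mul0r.
rewrite !mul1r; apply: le_trans (_ : \sum_g \sum_h adj g h * (pattern e f g h * cA) <= _).
  apply: ler_sum => g _; apply: ler_sum => h _.
  have [rgh|_] := boolP (r g h); last by rewrite !mul0r.
  by rewrite !mul1r mom_pattern //; [apply: contraTneq ref|apply: contraTneq rgh] => ->; rewrite rirr.
under eq_bigr => g _ do under eq_bigr => h _ do rewrite mulrA.
under eq_bigr => g _ do rewrite -mulr_suml.
by rewrite -mulr_suml ler_wpM2r // sum_pattern.
Qed.

(** In a regular graph the linear terms of the centred expansion are multiples of
[sum_e eta x e], hence vanish on the slice. *)
Lemma pair_count_qform x : x \in A ->
  \sum_e \sum_f adj e f * ((e \in x)%:R * (f \in x)%:R) =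
  qform x + p ^+ 2 * (N * d%:R).
Proof.
move=> xA; have E : \sum_e eta x e * d%:R = 0 by rewrite -mulr_suml sum_eta // mul0r.
have E1 : \sum_e \sum_f adj e f * eta x e = 0.
  by rewrite -[RHS]E; apply: eq_bigr => e _; rewrite -mulr_suml sum_adj mulrC.
have E2 : \sum_e \sum_f adj e f * eta x f = 0.
  rewrite exchange_big /= -[RHS]E1; apply: eq_bigr => e _; apply: eq_bigr => f _.
  by rewrite rsym.
have E0 : \sum_(g : T) \sum_h adj g h = N * d%:R :> R.
  by under eq_bigr => g _ do rewrite sum_adj; rewrite sumr_const mulr_natl.
transitivity (qform x + p * (\sum_e \sum_f adj e f * eta x e)
   + p * (\sum_e \sum_f adj e f * eta x f) + p ^+ 2 * \sum_(g : T) \sum_h adj g h); last first.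
  by rewrite E1 E2 E0 !mulr0 !addr0.
rewrite /qform !mulr_sumr -!big_split; apply: eq_bigr => e _ /=.
rewrite !mulr_sumr -!big_split; apply: eq_bigr => f _ /=.
by rewrite /eta; ring.
Qed.

End Slice.

(** * The variance of the number of wedges *)

Lemma npairsE (R : realType) k : (npairs k)%:R = k%:R * (k%:R - 1) / 2 :> R.
Proof.
apply: (@mulIf _ 2) => //; rewrite divfK // -natrM /npairs mulnC.
have -> : (2 * 'C(k, 2) = k * k.-1)%N by have := mul_bin_diag k 1; rewrite bin1; lia.
by case: k => [|k]; rewrite ?mul0r // natrM -natr1 addrK.
Qed.

Lemma half_sub_sqr (R : realType) (w q c : R) : 2 * w = q + c ->
  (w - c / 2) ^+ 2 = q ^+ 2 / 4.
Proof. by move=> h; have -> : w = (q + c) / 2; [lra|field]. Qed.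

Section Variance.
Variables (R : realType) (n m : nat).
Implicit Types (x : graph n).
Hypothesis n4 : (4 <= n)%N.
Hypothesis mN : (m <= npairs n)%N.
Local Notation A := (graphs_with n m).

Lemma npairs_ge6 : (6 <= npairs n)%N.
Proof. by apply: leq_trans (leq_bin2l 2 n4). Qed.

Lemma nwedges_pairs x :
  2 * (nwedges x)%:R = \sum_e \sum_f (ladj e f)%:R * ((e \in x)%:R * (f \in x)%:R) :> R.
Proof.
rewrite -[2 * _]natrM nwedges_ladj natr_sum big_mkcond; apply: eq_bigr => e _.
case: (e \in x); last by rewrite big1 // => f _; rewrite mul0r mulr0.
rewrite natr_sum big_mkcond; apply: eq_bigr => f _.
by rewrite mul1r; case: (f \in x); rewrite ?mulr1 ?mulr0.
Qed.

Lemma card_graphs_with_gt0 : (0 < #|A|)%N.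
Proof. by have := @card_slice_gt0 (edge n) m; rewrite card_edges; apply. Qed.

Lemma sum_meanV : \sum_(x in A) (nwedges x)%:R = meanV R n m * #|A|%:R.
Proof. by rewrite /meanV divfK // pnatr_eq0 -lt0n card_graphs_with_gt0. Qed.

(** The mean minimises the quadratic deviation, so the variance may be estimated
around any convenient constant. *)
Lemma sum_dev_sqr (c : R) :
  \sum_(x in A) ((nwedges x)%:R - meanV R n m) ^+ 2 <=
  \sum_(x in A) ((nwedges x)%:R - c) ^+ 2.
Proof.
rewrite -subr_ge0 -sumrB.
have -> : \sum_(x in A) (((nwedges x)%:R - c) ^+ 2 - ((nwedges x)%:R - meanV R n m) ^+ 2) =
   \sum_(x in A) ((meanV R n m - c) * 2 * (nwedges x)%:R + (c ^+ 2 - meanV R n m ^+ 2)).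
  by apply: eq_bigr => x _; ring.
rewrite big_split /= -mulr_sumr sum_meanV sumr_const -mulr_natr -mulrA.
set a := #|A|%:R; have : 0 <= a by []. 
have := sqr_ge0 (meanV R n m - c); move: (meanV R n m) => M; nra.
Qed.

(** The cancellation of the orders above [n^3] happens in passing to the centred
form of [pair_count_qform]. *)
Lemma varV_le : varV R n m <= 8 * n%:R ^+ 3.
Proof.
have T0 : (0 < #|{: edge n}|)%N by rewrite card_edges (leq_trans _ npairs_ge6).
have T6 : (6 <= #|{: edge n}|)%N by rewrite card_edges npairs_ge6.
have mT : (m <= #|{: edge n}|)%N by rewrite card_edges.
have deg := @ladj_deg n.
have q := qform_sqr R mT T0 T6 (@ladj_sym n) (@ladj_irr n) deg.
have pq := fun x => @pair_count_qform R _ m T0 _ _ (@ladj_sym n) deg x.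
rewrite card_edges npairsE in q.
rewrite /varV ler_pdivrMr ?ltr0n ?card_graphs_with_gt0 //.
set N : R := #|{: edge n}|%:R in pq; set dd : R := (2 * (n - 2))%:R in q pq.
set c := (dens R (edge n) m ^+ 2 * (N * dd)) / 2.
apply: le_trans (sum_dev_sqr c) _.
have -> : \sum_(x in A) ((nwedges x)%:R - c) ^+ 2 =
   (\sum_(x in A) qform R m (@ladj n) x ^+ 2) / 4.
  rewrite mulr_suml; apply: eq_bigr => x xA.
  have := pq x xA; rewrite -nwedges_pairs => h.
  exact: half_sub_sqr.
have n4' : 4 <= n%:R :> R by rewrite (ler_nat _ 4).
rewrite ler_pdivrMr //; apply: le_trans q _.
have -> : dd = 2 * (n%:R - 2) by rewrite /dd natrM natrB // (leq_trans _ n4).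
rewrite [leRHS]mulrAC ler_wpM2r //.
move: n4'; move: (n%:R : R) => k k4.
have -> : k * (k - 1) / 2 * (2 * (k - 2)) * (2 + 30 * (2 * (k - 2)) / (k * (k - 1) / 2)) =
  2 * k * (k - 1) * (k - 2) + 120 * (k - 2) ^+ 2.
  by field; rewrite !gt_eqF //; lra.
nra.
Qed.

Lemma sigmaV_le : sigmaV R n m <= 3 * (n%:R * Num.sqrt n%:R).
Proof.
have h0 : 0 <= 3 * (n%:R * Num.sqrt n%:R) :> R by rewrite !mulr_ge0 ?sqrtr_ge0.
rewrite -(ger0_norm h0) -sqrtr_sqr /sigmaV ler_wsqrtr //.
apply: le_trans varV_le _; rewrite !exprMn sqr_sqrtr //.
have : 0 <= n%:R ^+ 3 :> R by rewrite exprn_ge0.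
rewrite exprS; nra.
Qed.

End Variance.

(** * Degree-preserving swaps and a lower bound on exponential moments *)

Section Swap.
Variables (R : realType) (T K : finType) (A B : K -> T).
Hypotheses (Ainj : injective A) (Binj : injective B) (AB : forall k k', A k != B k').
Implicit Types (S : pred K) (e : T) (k : K) (x : {set T}).

(** The involution exchanging [A k] with [B k] for all [k] selected by [S]. *)
Definition swap S e : T :=
  if [pick k | S k && ((e == A k) || (e == B k))] is Some k
  then (if e == A k then B k else A k) else e.

Lemma swapA S k : swap S (A k) = if S k then B k else A k.
Proof.
rewrite /swap; case: pickP => [k' /andP [Sk']|nk].
  rewrite (negPf (AB _ _)) orbF => /eqP Ak; rewrite Ak eqxx.
  by rewrite (Ainj Ak) Sk'.
by have := nk k; rewrite eqxx andbT => ->.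
Qed.

Lemma swapB S k : swap S (B k) = if S k then A k else B k.
Proof.
rewrite /swap; case: pickP => [k' /andP [Sk']|nk].
  rewrite eq_sym (negPf (AB _ _)) /= => /eqP Bk.
  by rewrite (Binj Bk) Sk'.
by have := nk k; rewrite eqxx orbT andbT => ->.
Qed.

Lemma swap_out S e : (forall k, e != A k) -> (forall k, e != B k) -> swap S e = e.
Proof.
move=> nA nB; rewrite /swap; case: pickP => [k /andP [_]|//].
by rewrite (negPf (nA k)) (negPf (nB k)).
Qed.

Lemma swap_cases e :
  [\/ exists k, e = A k, exists k, e = B k |
      (forall k, e != A k) /\ (forall k, e != B k)].
Proof.
have [/existsP [k /eqP ->]|/existsPn nA] := boolP [exists k, e == A k].
  by constructor 1; exists k.
have [/existsP [k /eqP ->]|/existsPn nB] := boolP [exists k, e == B k].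
  by constructor 2; exists k.
by constructor 3.
Qed.

Lemma swapK S : involutive (swap S).
Proof.
move=> e; case: (swap_cases e) => [[k ->]|[k ->]|[nA nB]].
- by rewrite swapA; case E : (S k); rewrite ?swapA ?swapB E.
- by rewrite swapB; case E : (S k); rewrite ?swapA ?swapB E.
- by rewrite !swap_out.
Qed.

Lemma swap_diff S (g : T -> R) e : g (swap S e) - g e =
  \sum_k (S k)%:R * (((A k == e)%:R - (B k == e)%:R) * (g (B k) - g (A k))).
Proof.
case: (swap_cases e) => [[k ->]|[k ->]|[nA nB]].
- rewrite swapA (bigD1 k) //= eqxx eq_sym (negPf (AB _ _)) big1 ?addr0; last first.
    move=> k' /negPf nk; rewrite (inj_eq Ainj) nk eq_sym (negPf (AB _ _)).
    by rewrite subrr mul0r mulr0.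
  by case: (S k); rewrite ?subrr ?mul0r // subr0 !mul1r.
- rewrite swapB (bigD1 k) //= eqxx (negPf (AB _ _)) big1 ?addr0; last first.
    move=> k' /negPf nk; rewrite (inj_eq Binj) nk (negPf (AB _ _)).
    by rewrite subrr mul0r mulr0.
  by case: (S k); rewrite ?subrr ?mul0r // sub0r mul1r mulN1r opprB.
- rewrite swap_out // subrr big1 // => k _.
  by rewrite eq_sym (negPf (nA k)) eq_sym (negPf (nB k)) subrr mul0r mulr0.
Qed.

(** Exchanging [A k] and [B k] reverses this sign. *)
Definition imbalance x k : R := (A k \in x)%:R - (B k \in x)%:R.

Lemma imbalance_sqr x k : imbalance x k ^+ 2 = 0 \/ imbalance x k ^+ 2 = 1.
Proof.
rewrite /imbalance; case: (A k \in x); case: (B k \in x) => /=; rewrite ?subrr ?subr0 ?sub0r ?sqrrN ?expr1n ?expr0n /=;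
  by [left|right].
Qed.

Lemma sum_swap S (g : T -> R) x :
  \sum_(e in (swap S @^-1: x)%SET) g e =
  \sum_(e in x) g e + \sum_k (S k)%:R * (imbalance x k * (g (B k) - g (A k))).
Proof.
have -> : \sum_(e in (swap S @^-1: x)%SET) g e = \sum_(e in x) g (swap S e).
  rewrite (reindex_inj (can_inj (@swapK S))); apply: eq_bigl => e.
  by rewrite !inE swapK.
apply/eqP; rewrite addrC -subr_eq -sumrB; apply/eqP.
under eq_bigr => e _ do rewrite swap_diff.
rewrite exchange_big /=; apply: eq_bigr => k _.
rewrite -mulr_sumr -mulr_suml; congr (_ * (_ * _)).
rewrite sumrB /imbalance.
have h (c : T) : \sum_(e in x) (c == e)%:R = (c \in x)%:R :> R.
  rewrite big_mkcond -[RHS](sum_delta c (fun e => (e \in x)%:R)).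
  by apply: eq_bigr => e _; rewrite eq_sym; case: (e \in x); rewrite ?mulr1 ?mulr0.
by rewrite !h.
Qed.

End Swap.

Section Product.
Variables (R : realType) (l : nat).
Local Notation Z := {ffun 'I_l -> {set 'I_l}}.

Lemma sum_ffun_prod (F : 'I_l -> {set 'I_l} -> R) :
  \sum_(z : Z) \prod_i F i (z i) = \prod_i \sum_(y : {set 'I_l}) F i y.
Proof. by rewrite bigA_distr_bigA. Qed.

Lemma sum_ffun_coord0 (F : {set 'I_l} -> R) i :
  \sum_y F y = 0 -> \sum_(z : Z) F (z i) = 0.
Proof.
move=> F0; pose G j y := if j == i then F y else 1.
have -> : \sum_(z : Z) F (z i) = \sum_(z : Z) \prod_j G j (z j).
  apply: eq_bigr => z _; rewrite (bigD1 i) //= big1 ?mulr1 /G ?eqxx //.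
  by move=> j /negPf ->.
by rewrite sum_ffun_prod (bigD1 i) //= /G eqxx F0 mul0r.
Qed.

(** Flipping all signs at once shows that a linear term only increases the moment
generating function of the even part. *)
Lemma rad_quadratic_mgf_ge (r : 'I_l -> R) (s c : R) :
  (forall j, r j ^+ 2 = 0 \/ r j ^+ 2 = 1) -> 0 <= s -> s * l%:R <= 1 / 2 ->
  let h := \sum_j r j ^+ 2 in
  [/\ 0 <= h, h <= l%:R &
  expR (s ^+ 2 * (h ^+ 2 - h) / 16) * ncube R 'I_l <=
  \sum_(y : {set 'I_l}) expR (s * ((\sum_j sgn R y j * r j) ^+ 2 - h)
                              + c * \sum_j sgn R y j * r j)].
Proof.
move=> r01 s0 sl h; have := rad_square_mgf_ge (index_enum_uniq _) r01 s0 _.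
have -> : size (index_enum 'I_l) = l by rewrite -[RHS]card_ord cardT enumT.
move=> /(_ sl); rewrite -/h => -[h0 hl hh H]; split=> //.
apply: le_trans (_ : (1 + s ^+ 2 * (h ^+ 2 - h) / 8) * ncube R 'I_l <= _).
  rewrite ler_pM2r ?ncube_gt0 //.
  rewrite [X in expR X](_ : _ = s ^+ 2 * (h ^+ 2 - h) / 8 / 2); last by field.
  apply: expR_half_le.
  have sh : s * h <= 1 / 2 by nra.
  have sh0 : 0 <= s * h by nra.
  have s20 := sqr_ge0 s.
  by apply/andP; split; nra.
apply: le_trans H _.
rewrite [leRHS](sum_flip finset.setT); apply: ler_sum => y _.
have -> : \sum_j sgn R (symd y finset.setT) j * r j = - \sum_j sgn R y j * r j.
  by rewrite -sumrN; apply: eq_bigr => j _; rewrite sgn_symd {2}/sgn inE expr1 mulrN1 mulNr.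
set b := \sum_j _; set u := s * (b ^+ 2 - h).
rewrite sqrrN mulrN -/u !expRD -mulrDr -mulrA.
have := cosh_ge1 (c * b); rewrite /cosh => hc.
by rewrite ler_peMr ?expR_ge0.
Qed.

End Product.

Lemma twice_minus_ge (R : realType) (N S p g : R) : 2 <= N ->
  (N - 1) * S = - (p * (1 - p) * g) -> 0 <= p * (1 - p) * g ->
  2 * p * (1 - p) * g <= p * (1 - p) * g + p * (1 - p) * g - 2 * S.
Proof. by move=> N2 E q0; have : S <= 0; [nra|lra]. Qed.

Section SwapGraph.
Variables (R : realType) (n l : nat) (a b u : 'I_l -> 'I_n).
Hypotheses (ainj : injective a) (binj : injective b) (uinj : injective u).
Hypotheses (nab : forall i j, a i != b j) (nau : forall i j, a i != u j)
           (nbu : forall i j, b i != u j).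
Implicit Types (x : graph n) (i j : 'I_l) (v : 'I_n).
Local Notation Z := {ffun 'I_l -> {set 'I_l}}.

Lemma edge_card v w : v != w -> #|[set v; w]%SET| == 2%N.
Proof. by move=> vw; rewrite cards2 vw. Qed.

Definition Aedge (k : 'I_l * 'I_l) : edge n :=
  exist (fun e : {set 'I_n} => #|e| == 2%N) _ (edge_card (nau k.1 k.2)).
Definition Bedge (k : 'I_l * 'I_l) : edge n :=
  exist (fun e : {set 'I_n} => #|e| == 2%N) _ (edge_card (nbu k.1 k.2)).

Lemma Aedge_inj : injective Aedge.
Proof.
move=> [i j] [i' j'] /(congr1 val) /= /setP E.
have -> : j = j'.
  by have := E (u j); rewrite !inE eqxx orbT eq_sym (negPf (nau _ _)) => /esym /eqP /uinj.
by have := E (a i); rewrite !inE eqxx /= (negPf (nau _ _)) orbF => /esym /eqP /ainj ->.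
Qed.

Lemma Bedge_inj : injective Bedge.
Proof.
move=> [i j] [i' j'] /(congr1 val) /= /setP E.
have -> : j = j'.
  by have := E (u j); rewrite !inE eqxx orbT eq_sym (negPf (nbu _ _)) => /esym /eqP /uinj.
by have := E (b i); rewrite !inE eqxx /= (negPf (nbu _ _)) orbF => /esym /eqP /binj ->.
Qed.

Lemma ABedge k k' : Aedge k != Bedge k'.
Proof.
apply/eqP => /(congr1 val) /= /setP /(_ (a k.1)).
by rewrite !inE eqxx (negPf (nab _ _)) /= (negPf (nau _ _)).
Qed.

(** For each row [i] and column [j], the edges [a_i u_j] and [b_i u_j] are exchanged
or not. This keeps the number of edges and the degrees of all the [u_j], and
changes the degrees of [a_i] and [b_i] by opposite amounts. *)
Definition swap_graph (z : Z) x : graph n :=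
  (swap Aedge Bedge (fun k => k.2 \in z k.1) @^-1: x)%SET.

Local Notation imb x i j := (imbalance R Aedge Bedge x (i, j)).
Local Notation deg x v := ((vdeg x v)%:R : R).

(** The amount by which the degree of [b i] grows, at the expense of [a i]. *)
Definition moved (z : Z) x i : R := \sum_j (j \in z i)%:R * imb x i j.

Lemma degE x v : (vdeg x v)%:R = \sum_(e in x) (v \in val e)%:R :> R.
Proof. by rewrite natr_sum. Qed.

Lemma deg_swap z x v :
  deg (swap_graph z x) v =
  deg x v + \sum_i ((v == b i)%:R - (v == a i)%:R) * moved z x i.
Proof.
rewrite !degE sum_swap; [|exact: Aedge_inj|exact: Bedge_inj|exact: ABedge].
congr (_ + _); rewrite -(pair_bigA _ (fun i j => (j \in z i)%:R *
  (imb x i j * ((v \in val (Bedge (i, j)))%:R - (v \in val (Aedge (i, j)))%:R)))) /=.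
apply: eq_bigr => i _; rewrite /moved mulr_sumr; apply: eq_bigr => j _.
have mem2 w : w != u j -> (v \in [set w; u j]%SET)%:R = (v == w)%:R + (v == u j)%:R :> R.
  move=> wu; rewrite !inE; have [->|] := eqVneq v w; first by rewrite (negPf wu) addr0.
  by rewrite add0r.
by rewrite !mem2 //; ring.
Qed.

Lemma nwedges_deg x :
  2 * (nwedges x)%:R = \sum_v deg x v ^+ 2 - 2 * (nedges x)%:R.
Proof.
have := congr1 (fun k : nat => k%:R : R) (sum_vdeg_sqr x).
rewrite natr_sum natrD !natrM => h.
under eq_bigr => v _ do rewrite -natrX.
lra.
Qed.

Lemma nedges_swap z x : nedges (swap_graph z x) = nedges x.
Proof.
rewrite /nedges /swap_graph on_card_preimset //.
exists (swap Aedge Bedge (fun k => k.2 \in z k.1)) => e _;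
  by rewrite swapK //; [exact: Aedge_inj|exact: Bedge_inj|exact: ABedge].
Qed.

(** Half the sum of squared degrees determines the number of wedges once the
number of edges is fixed, and only the degrees of [a i] and [b i] move. *)
Lemma nwedges_swap z x : (nwedges (swap_graph z x))%:R =
  (nwedges x)%:R
  + \sum_i (moved z x i ^+ 2 + (deg x (b i) - deg x (a i)) * moved z x i).
Proof.
have h1 := nwedges_deg (swap_graph z x); have h0 := nwedges_deg x.
rewrite nedges_swap in h1.
pose y i := moved z x i.
pose w v : R := \sum_i ((v == b i)%:R - (v == a i)%:R) * y i.
have wb i : w (b i) = y i.
  rewrite /w -[RHS](sum_delta i y); apply: eq_bigr => j _.
  by rewrite (inj_eq binj) eq_sym [b i == _]eq_sym (negPf (nab _ _)) subr0.
have wa i : w (a i) = - y i.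
  rewrite /w -[in RHS](sum_delta i y) -sumrN; apply: eq_bigr => j _.
  by rewrite (inj_eq ainj) (negPf (nab _ _)) [i == j]eq_sym sub0r mulNr.
have pairing (g : 'I_n -> R) : \sum_v g v * w v = \sum_i (g (b i) - g (a i)) * y i.
  under eq_bigr => v _ do rewrite mulr_sumr.
  rewrite exchange_big; apply: eq_bigr => i _ /=.
  rewrite -(sum_delta (b i) g) -(sum_delta (a i) g) -sumrB mulr_suml.
  by apply: eq_bigr => v _; ring.
have E1 := pairing (fun v => deg x v).
have E2 : \sum_v w v ^+ 2 = 2 * \sum_i y i ^+ 2.
  under eq_bigr => v _ do rewrite expr2.
  rewrite pairing mulr_sumr; apply: eq_bigr => i _; rewrite wa wb; ring.
have E3 : \sum_v deg (swap_graph z x) v ^+ 2 =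
   \sum_v deg x v ^+ 2 + 2 * \sum_v deg x v * w v + \sum_v w v ^+ 2.
  rewrite mulr_sumr -!big_split; apply: eq_bigr => v _ /=.
  by rewrite deg_swap -/(w v); ring.
rewrite big_split /= -/y.
rewrite E1 E2 in E3.
move: h1 h0 E3; rewrite /y; lra.
Qed.

(** In terms of the signs of the swap pattern [z], the degree transfer is
[(rowsum - rowsign) / 2]. Expanding the square in [nwedges_swap] gives a part
[centre x] independent of [z] and one independent mean-zero term [fluct] per row,
of which [rowdiff] is the variance proxy and [tilt] the linear coefficient. *)
Definition rowdiff x i : R := \sum_j imb x i j ^+ 2.
Definition rowsum x i : R := \sum_j imb x i j.
Definition tilt x i : R := - (rowsum x i + (deg x (b i) - deg x (a i))) / 2.
Definition rowsign (y : {set 'I_l}) x i : R := \sum_j sgn R y j * imb x i j.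
Definition centre x : R := (nwedges x)%:R +
  \sum_i ((rowsum x i ^+ 2 + rowdiff x i) / 4 + (deg x (b i) - deg x (a i)) * rowsum x i / 2).
Definition fluct y x i : R :=
  (rowsign y x i ^+ 2 - rowdiff x i) / 4 + tilt x i * rowsign y x i.

Lemma nwedges_swap_centre z x :
  (nwedges (swap_graph z x))%:R = centre x + \sum_i fluct (z i) x i.
Proof.
rewrite nwedges_swap /centre -addrA; congr (_ + _); rewrite -big_split.
apply: eq_bigr => i _ /=.
have -> : moved z x i = (rowsum x i - rowsign (z i) x i) / 2.
  rewrite /moved /rowsum /rowsign -sumrB mulr_suml; apply: eq_bigr => j _.
  by rewrite /sgn; case: (j \in z i); rewrite ?expr1 ?expr0 /=; field.
by rewrite /fluct /tilt; field.
Qed.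

Lemma sum_fluct x i : \sum_(y : {set 'I_l}) fluct y x i = 0.
Proof.
rewrite big_split /= -mulr_sumr.
rewrite -mulr_suml sumrB [X in X - _](rad_square_mean _ (index_enum_uniq _)) sum_cst subrr mul0r add0r.
rewrite /rowsign exchange_big big1 ?mulr0 //= => j _.
rewrite -mulr_suml; apply/eqP; rewrite mulf_eq0; apply/orP; left; apply/eqP.
rewrite (sum_flip finset.setT) big1 // => y _.
by rewrite sgn_symd {3}/sgn inE expr1 mulrN1 subrr mul0r.
Qed.

Section Fixed.
Variable m : nat.
Hypothesis mN : (m <= #|{: edge n}|)%N.
Hypothesis T2 : (2 <= #|{: edge n}|)%N.
Local Notation G := (graphs_with n m).

Lemma sum_swap_graph z (F : graph n -> R) :
  \sum_(x in G) F (swap_graph z x) = \sum_(x in G) F x.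
Proof.
apply: (@sum_slice_preim R (edge n) m _ F); apply: swapK;
 [exact: Aedge_inj|exact: Bedge_inj|exact: ABedge].
Qed.

Let cZ : R := #|{: Z}|%:R.

Let cZE : cZ = \prod_(i < l) ncube R 'I_l.
Proof. by rewrite /cZ card_ffun prodr_const natrX. Qed.

Let cZ0 : 0 < cZ.
Proof. by rewrite cZE; apply: prodr_gt0 => i _; exact: ncube_gt0. Qed.

Lemma sum_centre : \sum_(x in G) centre x = \sum_(x in G) (nwedges x)%:R.
Proof.
apply: (mulfI (lt0r_neq0 cZ0)).
transitivity (\sum_(z : Z) \sum_(x in G) (nwedges (swap_graph z x))%:R : R).
  under [RHS]eq_bigr => z _ do under eq_bigr => x _ do rewrite nwedges_swap_centre.
  under [RHS]eq_bigr => z _ do rewrite big_split /=.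
  rewrite [RHS]big_split /= [X in _ = X + _]sumr_const.
  rewrite [X in _ + X]exchange_big /= [X in _ + X]big1 ?addr0.
    by rewrite mulr_natl; congr (_ *+ _); apply: eq_card.
  move=> x _; rewrite exchange_big big1 //= => i _.
  by rewrite (sum_ffun_coord0 (F := fun y => fluct y x i)) // sum_fluct.
under eq_bigr => z _ do rewrite (sum_swap_graph z (fun x => (nwedges x)%:R)).
by rewrite sumr_const mulr_natl; congr (_ *+ _); apply: eq_card.
Qed.

Let p := dens R (edge n) m.

(** Two distinct potential edges are negatively correlated under a fixed edge
count, so they differ with probability at least [2 p (1 - p)]. *)
Lemma mean_rowdiff i : 2 * p * (1 - p) * l%:R * #|G|%:R <= \sum_(x in G) rowdiff x i.
Proof.
rewrite exchange_big /= -[l in leLHS]card_ord mulrAC mulr_natr -sumr_const.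
apply: ler_sum => j _.
have T0 := leq_trans (isT : (0 < 2)%N) T2.
have := T2; rewrite -(ler_nat R) => N2.
have E := mean_eta2 R m T0 (ABedge (i, j) (i, j)).
have /andP [p0 p1] := dens01 R mN T0.
rewrite (eq_bigr (fun x => eta R m x (Aedge (i, j)) ^+ 2 + eta R m x (Bedge (i, j)) ^+ 2
   - 2 * (eta R m x (Aedge (i, j)) * eta R m x (Bedge (i, j))))); last first.
  by move=> x _; rewrite /imbalance /eta; ring.
rewrite sumrB big_split /= !mean_eta_sqr // -mulr_sumr -/p.
rewrite -/(slice (edge n) m) -/p in E *.
apply: twice_minus_ge N2 E _.
by rewrite !mulr_ge0 // subr_ge0.
Qed.

(** The swaps preserve the uniform law on graphs with [m] edges, so a random swap
pattern may be inserted. Given the graph, the rows are independent and each one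
contributes at least [exp (s^2 (h^2 - h) / 16)], where [s = kappa / 4] and [h] is
[rowdiff]. Jensen over the graph then only requires
the mean of the exponent, in which the centre cancels against [meanV]. *)
Lemma wedge_mgf_ge (kappa : R) : 0 <= kappa -> kappa * l%:R <= 2 ->
  let al := 2 * p * (1 - p) in
  #|G|%:R * expR (kappa ^+ 2 / 256 * (l%:R * (al ^+ 2 * l%:R ^+ 2 - l%:R))) <=
  \sum_(x in G) expR (kappa * ((nwedges x)%:R - meanV R n m)).
Proof.
move=> k0 kl /=; set al := 2 * p * (1 - p); set e := meanV R n m.
have T0 := leq_trans (isT : (0 < 2)%N) T2.
have G0 : (0 < #|G|)%N by exact: (@card_slice_gt0 (edge n) m mN).
have G0' : 0 < #|G|%:R :> R by rewrite ltr0n.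
pose s := kappa / 4.
have s0 : 0 <= s by rewrite /s; lra.
have sl : s * l%:R <= 1 / 2 by rewrite /s; lra.
have fac x i := @rad_quadratic_mgf_ge R l (fun j => imb x i j) s (kappa * tilt x i)
   (fun j => imbalance_sqr R Aedge Bedge x (i, j)) s0 sl.
have rd0 x i : 0 <= rowdiff x i by case: (fac x i).
have rdl x i : rowdiff x i <= l%:R by case: (fac x i).
pose w x : R := kappa * (centre x - e) + s ^+ 2 / 16 * \sum_i (rowdiff x i ^+ 2 - rowdiff x i).
apply: le_trans (_ : \sum_(x in G) expR (w x) <= _); last first.
  rewrite -(ler_pM2l cZ0).
  have -> : cZ * \sum_(x in G) expR (kappa * ((nwedges x)%:R - e)) =
      \sum_(x in G) \sum_(z : Z) expR (kappa * ((nwedges (swap_graph z x))%:R - e)).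
    rewrite exchange_big /=.
    under [RHS]eq_bigr => z _ do rewrite (sum_swap_graph z (fun x => expR (kappa * ((nwedges x)%:R - e)))).
    by rewrite sumr_const mulr_natl; congr (_ *+ _); apply: eq_card.
  rewrite mulr_sumr; apply: ler_sum => x _.
  have -> : \sum_(z : Z) expR (kappa * ((nwedges (swap_graph z x))%:R - e)) =
     expR (kappa * (centre x - e)) * \prod_i \sum_(y : {set 'I_l}) expR (kappa * fluct y x i).
    rewrite -sum_ffun_prod mulr_sumr; apply: eq_bigr => z _.
    by rewrite nwedges_swap_centre -expR_sum -expRD -mulr_sumr; congr expR; ring.
  rewrite /w expRD mulrCA ler_pM2l ?expR_gt0 // cZE mulr_sumr expR_sum -big_split /=.
  apply: ler_prod => i _; apply/andP; split.
    by rewrite mulr_ge0 ?expR_ge0 // ltW // ncube_gt0.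
  case: (fac x i) => _ _; rewrite mulrC -/(rowdiff x i) -/(rowsign _ x i).
  rewrite [X in expR X](_ : _ = s ^+ 2 / 16 * (rowdiff x i ^+ 2 - rowdiff x i)); last by field.
  move=> h; apply: le_trans h _; rewrite le_eqVlt; apply/orP; left; apply/eqP.
  apply: eq_bigr => y _; congr expR; by rewrite -/(rowsign y x i) /fluct /s; field.
apply: le_trans _ (jensen_expR w G0); rewrite ler_pM2l // ler_expR ler_pdivlMr //.
have eG : \sum_(x in G) (nwedges x)%:R = e * #|G|%:R.
  by rewrite /e /meanV divfK // gt_eqF.
rewrite /w big_split /= -mulr_sumr sumrB sum_centre eG sumr_const -[e *+ _]mulr_natr.
rewrite subrr mulr0 add0r -mulr_sumr exchange_big /=.
apply: le_trans (_ : s ^+ 2 / 16 * (\sum_(i < l) (al ^+ 2 * l%:R ^+ 2 - l%:R) * #|G|%:R) <= _).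
  rewrite sumr_const card_ord -mulr_natl /s le_eqVlt; apply/orP; left; apply/eqP; by field.
apply: ler_wpM2l; first by have := sqr_ge0 s; lra.
apply: ler_sum => i _; rewrite sumrB.
have h1 : \sum_(x in G) rowdiff x i <= l%:R * #|G|%:R.
  by rewrite mulr_natr -sumr_const; apply: ler_sum.
have h2 := mean_rowdiff i; rewrite -/al in h2.
have al0 : 0 <= al.
  have /andP [p0 p1] := dens01 R mN T0.
  by rewrite /al !mulr_ge0 // subr_ge0.
(* E h^2 >= (E h)^2, in the linear form 2 a h - a^2 <= h^2 with a = al l *)
have h3 : \sum_(x in G) (2 * (al * l%:R) * rowdiff x i - (al * l%:R) ^+ 2) <=
   \sum_(x in G) rowdiff x i ^+ 2.
  apply: ler_sum => x _; have := sqr_ge0 (al * l%:R - rowdiff x i); lra.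
move: h3; rewrite sumrB -mulr_sumr sumr_const -mulr_natr => h3.
have l0 : 0 <= al * l%:R by rewrite mulr_ge0.
rewrite mulrBl; apply: lerB => //.
apply: le_trans h3; move: h2; set S1 := \sum_(x in G) _; set g : R := #|G|%:R.
nra.
Qed.

End Fixed.
End SwapGraph.

(** * Acceptance probability under strong interaction *)

Section Blocks.
Variable n : nat.
Let l := (n %/ 3)%N.

Lemma block_lt (c : 'I_3) (i : 'I_l) : (c * l + i < n)%N.
Proof.
have := ltn_ord c; have := ltn_ord i; rewrite /l; case: i => i /= _; case: c => c /= _.
by case: c => [|[|[|c]]] // ; lia.
Qed.

(** Three disjoint blocks of [n / 3] vertices, used as the [a], [b] and [u] vertices
of the swaps. *)
Definition block (c : 'I_3) (i : 'I_l) : 'I_n := Ordinal (block_lt c i).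

Lemma block_inj c : injective (block c).
Proof. by move=> i j /(congr1 val) /= /addnI /val_inj. Qed.

Lemma block_neq c c' i j : c != c' -> block c i != block c' j.
Proof.
apply: contra_neq => /(congr1 val) /= E; apply: val_inj.
have l0 : (0 < l)%N := leq_ltn_trans (leq0n i) (ltn_ord i).
by have := congr1 (divn^~ l) E; rewrite !divnMDl // !divn_small ?addn0.
Qed.

End Blocks.

Section StrongRegime.
Variable (R : realType).
Implicit Types (delta kappa theta T lam : R) (n m : nat).

(** The factors come from [al^2 l^2 - l >= delta^2 l^2 / 8], from [l >= n / 6], and
from the 256 of [wedge_mgf_ge]. *)
Definition rate delta : R := delta ^+ 2 / 8 / 216 / 256.

Lemma rate_gt0 delta : 0 < delta < 1 / 2 -> 0 < rate delta.
Proof. by move=> /andP [d0 _]; rewrite !divr_gt0 ?ltr0n ?exprn_gt0. Qed.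

Lemma rate_bound (delta al nn l kappa : R) : 0 < delta < 1 / 2 -> delta / 2 <= al ->
  0 < nn -> nn / 6 <= l -> 48 <= delta ^+ 2 * nn ->
  rate delta * (kappa ^+ 2 * nn ^+ 3) <=
  kappa ^+ 2 / 256 * (l * (al ^+ 2 * l ^+ 2 - l)).
Proof.
move=> /andP [d0 d1] al0 nn0 ln dn.
have k0 := sqr_ge0 kappa; move: (kappa ^+ 2) k0 => K K0.
have al2 : delta ^+ 2 / 4 <= al ^+ 2 by nra.
have d2 : 0 < delta ^+ 2 by rewrite exprn_gt0.
rewrite /rate; move: (delta ^+ 2) (al ^+ 2) d2 dn al2 => D A D0 dn A0.
have l0 : 0 < l by lra.
have Dl : 8 <= D * l.
  have h : D * (nn / 6) <= D * l by rewrite ler_pM2l.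
  lra.
have l2 : 0 < l ^+ 2 by rewrite exprn_gt0.
have h1 : D / 8 * l ^+ 2 <= A * l ^+ 2 - l.
  have : (D / 4) * l ^+ 2 <= A * l ^+ 2 by rewrite ler_pM2r //; lra.
  nra.
have h2 : D / 8 * l ^+ 3 <= l * (A * l ^+ 2 - l).
  by rewrite exprSr mulrA [leLHS]mulrC ler_pM2l.
have h3 : nn ^+ 3 / 216 <= l ^+ 3.
  have -> : nn ^+ 3 / 216 = (nn / 6) ^+ 3 by field.
  by rewrite lerXn2r // nnegrE; lra.
have h4 : D / 8 * (nn ^+ 3 / 216) <= D / 8 * l ^+ 3 by rewrite ler_pM2l //; lra.
have h5 : K / 256 * (D / 8 * (nn ^+ 3 / 216)) <= K / 256 * (l * (A * l ^+ 2 - l)).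
  by apply: ler_wpM2l; [lra|apply: le_trans h4 h2].
lra.
Qed.

Lemma dens_variance (delta p : R) : 0 < delta < 1 / 2 -> delta / 2 <= p <= 1 - delta / 2 ->
  delta / 2 <= 2 * p * (1 - p).
Proof. move=> /andP [d0 d1] /andP [p0 p1]; nra. Qed.

Lemma Sset_dens delta n m : (4 <= n)%N -> Sset delta n m ->
  delta / 2 <= dens R (edge n) m <= 1 - delta / 2.
Proof.
move=> n4 /andP [mN /andP [h1 h2]].
have N0 : 0 < (npairs n)%:R :> R by rewrite ltr0n (leq_trans _ (npairs_ge6 n4)).
by rewrite /dens card_edges ler_pdivlMr // ler_pdivrMr // h1 h2.
Qed.

Lemma wedge_mgf_strong delta kappa n m : (4 <= n)%N -> 0 < delta < 1 / 2 ->
  48 <= delta ^+ 2 * n%:R -> Sset delta n m -> 0 <= kappa -> kappa * n%:R <= 1 ->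
  #|graphs_with n m|%:R * expR (rate delta * (kappa ^+ 2 * n%:R ^+ 3)) <=
  \sum_(x in graphs_with n m) expR (kappa * ((nwedges x)%:R - meanV R n m)).
Proof.
move=> n4 hd dn Sm k0 kn; set l := (n %/ 3)%N.
have nn0 : 0 < n%:R :> R by rewrite ltr0n (leq_trans _ n4).
have ln : n%:R / 6 <= l%:R :> R.
  rewrite ler_pdivrMr // -natrM ler_nat /l; lia.
have ln' : l%:R <= n%:R :> R by rewrite ler_nat /l; lia.
have kl : kappa * l%:R <= 2.
  by apply: le_trans (_ : kappa * n%:R <= _); [rewrite ler_wpM2l|lra].
have al := dens_variance hd (Sset_dens n4 Sm).
have mN : (m <= npairs n)%N by case/andP: Sm.
have mT := mN; rewrite -card_edges in mT.
have T2 := leq_trans (isT : (2 <= 6)%N) (npairs_ge6 n4); rewrite -card_edges in T2.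
pose c0 : 'I_3 := ord0; pose c2 : 'I_3 := ord_max; pose c1 : 'I_3 := inord 1.
have n01 : c0 != c1 by rewrite -val_eqE /= inordK.
have n02 : c0 != c2 by [].
have n12 : c1 != c2 by rewrite -val_eqE /= inordK.
have H := @wedge_mgf_ge R n l (@block n c0) (@block n c1) (@block n c2) (@block_inj n c0)
  (@block_inj n c1) (@block_inj n c2) (fun i j => block_neq i j n01)
  (fun i j => block_neq i j n02) (fun i j => block_neq i j n12) m mT T2 kappa k0 kl.
apply: le_trans H; rewrite ler_wpM2l // ler_expR.
exact: rate_bound.
Qed.

(** If [f] has a large exponential moment at [kappa], then tilting by any stronger
[theta] leaves little mass on [f < 0]: there [e^(theta f)] is at most 1, whereas on
[f >= 0] it dominates [e^(kappa f)]. *)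
Lemma tilted_lower_tail (I : finType) (G : {set I}) (f : I -> R) kappa theta (q : R) :
  0 <= kappa -> kappa <= theta -> 
  #|G|%:R * q <= \sum_(x in G) expR (kappa * f x) ->
  (\sum_(x in G | f x < 0) expR (theta * f x)) * (q - 1) <= \sum_(x in G) expR (theta * f x).
Proof.
move=> k0 kt hq.
have neg (t : R) : 0 <= t -> \sum_(x in G | f x < 0) expR (t * f x) <= #|G|%:R.
  move=> t0; apply: le_trans (_ : \sum_(x in G) 1 <= _); last by rewrite sumr_const.
  rewrite big_mkcondr; apply: ler_sum => x _; case: ifP => // fx.
  by rewrite expR_le1; apply: mulr_ge0_le0 => //; exact: ltW.
have split (t : R) : \sum_(x in G) expR (t * f x) =
   \sum_(x in G | f x < 0) expR (t * f x) + \sum_(x in G | ~~ (f x < 0)) expR (t * f x).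
  exact: bigID.
have pos : \sum_(x in G | ~~ (f x < 0)) expR (kappa * f x) <=
           \sum_(x in G | ~~ (f x < 0)) expR (theta * f x).
  apply: ler_sum => x /andP [_]; rewrite -leNgt => fx.
  by rewrite ler_expR ler_wpM2r.
have n1 := neg kappa k0; have n2 := neg theta (le_trans k0 kt).
have s1 := split kappa; have s2 := split theta.
have a0 : 0 <= \sum_(x in G | f x < 0) expR (theta * f x).
  by apply: sumr_ge0 => x _; exact: expR_ge0.
move: hq n1 n2 s1 s2 a0 pos.
set a := \sum_(x in G | f x < 0) expR (theta * f x).
set b := \sum_(x in G | f x < 0) expR (kappa * f x).
set c := \sum_(x in G | ~~ (f x < 0)) expR (theta * f x).
set d := \sum_(x in G | ~~ (f x < 0)) expR (kappa * f x).
move: (\sum_(x in G) _) (\sum_(x in G) _) => A B.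
have : 0 <= #|G|%:R :> R by []. move: (#|G|%:R : R) => g.
move=> g0 hq n1 n2 s1 s2 a0 pos.
have [q1|q1] := leP 1 q; first by nra.
have : 0 <= c by apply: sumr_ge0 => x _; exact: expR_ge0.
nra.
Qed.

Definition accept delta T n (x : graph n) : bool := ~~ canonical_decision delta T x.

Lemma sum_edge_classes n (P : pred (graph n)) (F : graph n -> R) :
  \sum_(x | P x) F x =
  \sum_(m < (npairs n).+1) \sum_(x in graphs_with n m | P x) F x.
Proof.
have lt (x : graph n) : (nedges x < (npairs n).+1)%N by rewrite ltnS -card_edges; exact: max_card.
rewrite (partition_big (fun x => Ordinal (lt x)) predT) //=.
apply: eq_bigr => m _; apply: eq_bigl => x.
by rewrite inE andbC -val_eqE.
Qed.

Lemma zero_sigma n m (x : graph n) : x \in graphs_with n m -> sigmaV R n m = 0 ->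
  (nwedges x)%:R = meanV R n m.
Proof.
move=> xG /eqP; rewrite sqrtr_eq0 /varV => h.
have g0 : 0 < #|graphs_with n m|%:R :> R by rewrite ltr0n; apply/card_gt0P; exists x.
move: h; rewrite pmulr_lle0 ?invr_gt0 // => h.
apply/eqP; rewrite -subr_eq0 -sqrf_eq0; apply/eqP.
have sq0 y : y \in graphs_with n m -> 0 <= ((nwedges y)%:R - meanV R n m) ^+ 2 by rewrite sqr_ge0.
apply: (psumr_eq0P sq0 _ xG).
by apply/eqP; rewrite eq_le h /=; apply: sumr_ge0 => y _; exact: sqr_ge0.
Qed.

(** If [sigmaV] vanishes then the wedge count is constant on the class, and the
bound still holds because the right-hand margin is positive. *)
Lemma accept_small delta T n (x : graph n) : (4 <= n)%N -> 0 < T -> accept delta T x ->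
  (nwedges x)%:R - meanV R n (nedges x) - T * (3 * (n%:R * Num.sqrt n%:R)) < 0.
Proof.
move=> n4 T0; rewrite /accept negb_or negbK -ltNge => /andP [/andP [mN _]].
set m := nedges x in mN *; set s := sigmaV R n m.
have w0 : 0 < n%:R * Num.sqrt n%:R :> R.
  by rewrite mulr_gt0 ?sqrtr_gt0 // ltr0n (leq_trans _ n4).
have s0 : 0 <= s by exact: sqrtr_ge0.
have sw : s <= 3 * (n%:R * Num.sqrt n%:R) by exact: sigmaV_le.
have Tw : 0 < T * (3 * (n%:R * Num.sqrt n%:R)) by apply: mulr_gt0 => //; exact: mulr_gt0.
have [s00|sn0] := eqVneq s 0.
  have -> : (nwedges x)%:R = meanV R n m.
    by apply: zero_sigma => //; rewrite inE.
  by rewrite subrr sub0r oppr_lt0.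
have sp : 0 < s by rewrite lt0r sn0.
rewrite ltr_pdivrMr // => h; rewrite subr_lt0; apply: lt_le_trans h _.
by rewrite ler_pM2l.
Qed.

(** Conditionally on the number of edges the model is the uniform law tilted by
[exp (theta V)], with [theta >= kappa = lam / n^(3/2)]. The threshold is chosen so
that passing from [meanV] to the acceptance limit costs half of the exponent
[rate * lam^2] of [wedge_mgf_strong]. *)
Lemma ergm_accept delta T n (b1 b2 : R) lam : (4 <= n)%N -> 0 < delta < 1 / 2 ->
  48 <= delta ^+ 2 * n%:R -> 0 < lam -> lam <= Num.sqrt n%:R ->
  lam / Num.sqrt n%:R <= 2 * b2 -> T = rate delta * lam / 6 ->
  (\sum_(x : graph n | accept delta T x) ergm b1 b2 x) * (rate delta * lam ^+ 2 / 2) <= 1.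
Proof.
move=> n4 hd dn l0 ln lb TE.
have r0 : 0 < rate delta := rate_gt0 hd.
have T0 : 0 < T by rewrite TE divr_gt0 // mulr_gt0.
have nn0 : 0 < n%:R :> R by rewrite ltr0n (leq_trans _ n4).
set sq : R := Num.sqrt n%:R in ln lb *; have sq0 : 0 < sq by rewrite sqrtr_gt0.
have sqE : sq ^+ 2 = n%:R by rewrite sqr_sqrtr // ltW.
pose w : R := n%:R * sq; have w0 : 0 < w by exact: mulr_gt0.
pose kappa := lam / w; pose theta : R := 2 * b2 / n%:R.
have k0 : 0 <= kappa by rewrite divr_ge0 ?ltW.
have kt : kappa <= theta.
  have -> : kappa = lam / sq / n%:R by rewrite /kappa /w; field; rewrite !gt_eqF.
  by rewrite /theta ler_pM2r ?invr_gt0.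
have kn : kappa * n%:R <= 1.
  have -> : kappa * n%:R = lam / sq by rewrite /kappa /w; field; rewrite !gt_eqF.
  by rewrite ler_pdivrMr // mul1r.
have wE : w ^+ 2 = n%:R ^+ 3 by rewrite /w exprMn sqE; ring.
have kw : kappa ^+ 2 * n%:R ^+ 3 = lam ^+ 2.
  by rewrite -wE -exprMn /kappa divfK // gt_eqF.
set Zs := \sum_(x : graph n) expR (hamiltonian b1 b2 x).
have Z0 : 0 < Zs.
  rewrite /Zs (bigD1 finset.set0) //=; apply: ltr_wpDr (expR_gt0 _).
  by apply: sumr_ge0 => x _; exact: expR_ge0.
pose q := expR (rate delta * lam ^+ 2 / 2).
have q1 : rate delta * lam ^+ 2 / 2 <= q - 1.
  by have := expR_ge1Dx (rate delta * lam ^+ 2 / 2); rewrite -/q; lra.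
have a0 : 0 <= \sum_(x : graph n | accept delta T x) expR (hamiltonian b1 b2 x).
  by apply: sumr_ge0 => x _; exact: expR_ge0.
suff key : (\sum_(x : graph n | accept delta T x) expR (hamiltonian b1 b2 x)) * (q - 1) <= Zs.
  rewrite /ergm -/Zs -mulr_suml mulrAC ler_pdivrMr // mul1r; apply: le_trans key.
  by rewrite ler_wpM2l.
rewrite /Zs [leRHS](sum_edge_classes predT) (sum_edge_classes (fun x : graph n => accept delta T x)) mulr_suml.
apply: ler_sum => m _; rewrite [leRHS](eq_bigl (mem (graphs_with n m))); last first.
  by move=> x; rewrite andbT.
pose Y := T * (3 * w).
pose f (x : graph n) : R := (nwedges x)%:R - meanV R n m - Y.
(* edge counts outside the window are always rejected *)
have [Sm|nSm] := boolP (Sset delta n m); last first.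
  rewrite big1 ?mul0r; first by apply: sumr_ge0 => x _; exact: expR_ge0.
  move=> x /andP []; rewrite inE => /eqP xm.
  by rewrite /accept /canonical_decision xm nSm.
pose C := expR (2 * b1 * m%:R + theta * (meanV R n m + Y)).
have hamE x : x \in graphs_with n m -> expR (hamiltonian b1 b2 x) = C * expR (theta * f x).
  rewrite inE => /eqP xm; rewrite -expRD hamiltonianE xm; congr expR.
  by rewrite /f /theta; ring.
rewrite [leRHS](eq_bigr (fun x => C * expR (theta * f x))) //.
rewrite -mulr_sumr.
apply: le_trans (_ : (\sum_(x in graphs_with n m | f x < 0) C * expR (theta * f x)) * (q - 1) <= _).
  rewrite ler_wpM2r //; first by apply: le_trans q1; rewrite divr_ge0 // mulr_ge0 ?sqr_ge0 // ltW.
  rewrite big_mkcondr [leRHS]big_mkcondr; apply: ler_sum => x xG.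
  case: ifP => [ax|_]; last first.
    by case: ifP => // _; rewrite mulr_ge0 ?expR_ge0.
  have -> : f x < 0.
    have := accept_small n4 T0 ax; move: xG; rewrite inE => /eqP ->.
    by rewrite /f /Y /w.
  by rewrite hamE.
rewrite -mulr_sumr -mulrA ler_pM2l ?expR_gt0 //.
apply: (tilted_lower_tail k0 kt).
have := wedge_mgf_strong n4 hd dn Sm k0 kn; rewrite kw => H.
rewrite -(ler_pM2l (expR_gt0 (kappa * Y))) mulr_sumr.
rewrite [leRHS](eq_bigr (fun x : graph n => expR (kappa * ((nwedges x)%:R - meanV R n m)))); last first.
  by move=> x _; rewrite -expRD; congr expR; rewrite /f; ring.
apply: le_trans H; rewrite mulrCA ler_wpM2l // /q -expRD ler_expR.
have -> : kappa * Y = rate delta * lam ^+ 2 / 2.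
  by rewrite /kappa /Y TE; field; rewrite gt_eqF.
lra.
Qed.

End StrongRegime.

(** * Errors of the canonical test *)

Section Gnp.
Variables (R : realType) (n : nat) (p : R).
Implicit Types (x : graph n) (e f g : edge n).

Lemma gnp_prod x : gnp p x = \prod_e (if e \in x then p else 1 - p).
Proof.
rewrite (bigID (mem x)) /= (eq_bigr (fun=> p)); last by move=> e ->.
rewrite [X in _ * X](eq_bigr (fun=> 1 - p)); last by move=> e /negPf ->.
rewrite !prodr_const /gnp /nedges; congr (_ * _ ^+ _).
by rewrite -card_edges -(cardC (mem x)) addKn.
Qed.

(** Independence of the edges. *)
Lemma gnp_expect_prod (u v : edge n -> R) :
  \sum_x gnp p x * \prod_g (if g \in x then u g else v g) =
  \prod_g (p * u g + (1 - p) * v g).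
Proof.
rewrite bigA_distr; apply: eq_bigr => x _.
rewrite gnp_prod -big_split; apply: eq_bigr => g _ /=.
by case: (g \in x).
Qed.

Lemma gnp_total : \sum_(x : graph n) gnp p x = 1.
Proof.
have := gnp_expect_prod (fun=> 1) (fun=> 1).
rewrite [RHS]big1; last by move=> g _; ring.
move=> <-; apply: eq_bigr => x _; rewrite big1 ?mulr1 // => g _.
by case: (g \in x).
Qed.

Let xi x e : R := (e \in x)%:R - p.

Lemma gnp_cov e f :
  \sum_x gnp p x * (xi x e * xi x f) = (e == f)%:R * (p * (1 - p)).
Proof.
pose u e g : R := if g == e then 1 - p else 1.
pose v e g : R := if g == e then - p else 1.
have xiE x e0 : xi x e0 = \prod_g (if g \in x then u e0 g else v e0 g).
  rewrite (bigD1 e0) //= big1 ?mulr1; last first.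
    by move=> g /negPf ge; rewrite /u /v ge; case: (g \in x).
  by rewrite /u /v eqxx /xi; case: (e0 \in x); rewrite ?sub0r.
transitivity (\sum_x gnp p x * \prod_g (if g \in x then u e g * u f g else v e g * v f g)).
  apply: eq_bigr => x _; rewrite !xiE -big_split; congr (_ * _).
  by apply: eq_bigr => g _ /=; case: (g \in x).
rewrite gnp_expect_prod (bigD1 e) //= /u /v eqxx.
have [<-|ef] := eqVneq e f.
  rewrite big1; first by rewrite mul1r; ring.
  by move=> g /negPf ->; ring.
by rewrite (_ : p * ((1 - p) * 1) + (1 - p) * (- p * 1) = 0) ?mul0r //; ring.
Qed.

Lemma gnp_variance :
  \sum_(x : graph n) gnp p x * ((nedges x)%:R - p * (npairs n)%:R) ^+ 2 = p * (1 - p) * (npairs n)%:R.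
Proof.
have E (x : graph n) : (nedges x)%:R - p * (npairs n)%:R = \sum_e xi x e.
  rewrite sumrB sumr_const -[p *+ _]mulr_natr -card_edges; congr (_ - _ * _).
  by rewrite /nedges -sum1_card natr_sum big_mkcond; apply: eq_bigr => e _; case: (e \in x).
transitivity (\sum_e \sum_f \sum_x gnp p x * (xi x e * xi x f)).
  rewrite (eq_bigr (fun x => \sum_e \sum_f gnp p x * (xi x e * xi x f))); last first.
    move=> x _; rewrite E expr2 mulr_suml mulr_sumr; apply: eq_bigr => e _.
    by rewrite mulr_sumr mulr_sumr.
  by rewrite exchange_big; apply: eq_bigr => e _; rewrite exchange_big.
rewrite (eq_bigr (fun=> p * (1 - p))); last first.
  move=> e _; rewrite -[RHS](sum_delta e (fun=> p * (1 - p))).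
  by apply: eq_bigr => f _; rewrite gnp_cov eq_sym.
by rewrite sumr_const -[LHS]mulr_natr card_edges.
Qed.

Hypothesis p01 : 0 <= p <= 1.

Lemma gnp_ge0 x : 0 <= gnp p x.
Proof.
by case/andP: p01 => p0 p1; rewrite mulr_ge0 ?exprn_ge0 // subr_ge0.
Qed.

Lemma gnp_edges_tail delta : 0 < delta -> delta < p < 1 - delta ->
  (\sum_(x : graph n | ~~ Sset delta n (nedges x)) gnp p x) * (delta ^+ 2 * (npairs n)%:R) <= 1.
Proof.
move=> d0 /andP [p1 p2].
set N : R := (npairs n)%:R.
have [N0|N0] := eqVneq N 0; first by rewrite N0 !mulr0.
have Np : 0 < N by rewrite lt0r N0 /=.
rewrite -(ler_pM2r Np) mul1r.
set S := \sum_(x | _) _.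
apply: le_trans (_ : 4 * \sum_(x : graph n) gnp p x * ((nedges x)%:R - p * N) ^+ 2 <= _); last first.
  rewrite gnp_variance -/N; have := sqr_ge0 (2 * p - 1); nra.
rewrite -[leLHS]mulrA mulr_suml mulr_sumr big_mkcond; apply: ler_sum => x _.
have g0 := gnp_ge0 x.
case: ifP => [nS|_]; last first.
  by rewrite mulr_ge0 // mulr_ge0 // sqr_ge0.
rewrite [leRHS]mulrCA ler_wpM2l //.
have mN : (nedges x <= npairs n)%N by rewrite -card_edges; exact: max_card.
move: nS; rewrite /Sset mN /= -/N negb_and -!ltNge.
move: ((nedges x)%:R : R) => k h.
have dN : 0 < delta * N by rewrite mulr_gt0.
have h1 : delta * N < p * N by rewrite ltr_pM2r.
have h2 : p * N < (1 - delta) * N by rewrite ltr_pM2r.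
case/orP: h => h.
  have : delta / 2 * N <= p * N - k by lra.
  move: (p * N) h1 h2 => q h1 h2 h3.
  have : (delta / 2 * N) ^+ 2 <= (q - k) ^+ 2 by rewrite lerXn2r ?nnegrE //; lra.
  lra.
have : delta / 2 * N <= k - p * N by lra.
move: (p * N) h1 h2 => q h1 h2 h3.
have : (delta / 2 * N) ^+ 2 <= (k - q) ^+ 2 by rewrite lerXn2r ?nnegrE //; lra.
lra.
Qed.

(** Chebyshev's inequality on each edge class; when [sigmaV] vanishes the quotient is
0, which lies below the positive threshold. *)
Lemma slice_chebyshev m (T : R) : 0 < T -> (m <= npairs n)%N ->
  #|[set x in graphs_with n m |
      (T <= ((nwedges x)%:R - meanV R n m) / sigmaV R n m)%R]%SET|%:R * T ^+ 2
    <= #|graphs_with n m|%:R :> R.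
Proof.
move=> T0 mN; set B := [set x in _ | _]%SET.
have G0 : 0 < #|graphs_with n m|%:R :> R by rewrite ltr0n card_graphs_with_gt0.
have s0 : 0 <= sigmaV R n m by exact: sqrtr_ge0.
have [s00|sn0] := eqVneq (sigmaV R n m) 0.
  have -> : B = finset.set0.
    by apply/setP => x; rewrite !inE s00 invr0 mulr0 leNgt T0 andbF.
  by rewrite cards0 mul0r ltW.
have sp : 0 < sigmaV R n m by rewrite lt0r sn0.
have vE : sigmaV R n m ^+ 2 * #|graphs_with n m|%:R =
   \sum_(x in graphs_with n m) ((nwedges x)%:R - meanV R n m) ^+ 2.
  rewrite sqr_sqrtr; first by rewrite /varV divfK // gt_eqF.
  by rewrite /varV divr_ge0 // sumr_ge0 // => x _; exact: sqr_ge0.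
rewrite -(ler_pM2l (exprn_gt0 2 sp)) vE mulrCA mulr_natl -sumr_const.
rewrite [leRHS](bigID (mem B)) /=; apply: ler_wpDr.
  by apply: sumr_ge0 => x _; exact: sqr_ge0.
rewrite [leRHS](eq_bigl (mem B)); last by move=> x; rewrite !inE; case: (nedges x == m).
apply: ler_sum => x; rewrite inE => /andP [_].
rewrite ler_pdivlMr // => h; rewrite -exprMn lerXn2r // ?nnegrE.
- by rewrite mulr_ge0 // ltW.
- by apply: le_trans h; rewrite mulr_ge0 // ltW.
- by rewrite mulrC.
Qed.

Lemma gnp_wedge_tail delta (T : R) : 0 < T ->
  (\sum_(x : graph n | Sset delta n (nedges x) && canonical_decision delta T x) gnp p x)
    * T ^+ 2 <= 1.
Proof.
move=> T0; rewrite -gnp_total [leRHS](sum_edge_classes predT).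
rewrite (sum_edge_classes (fun x : graph n => Sset delta n (nedges x) && canonical_decision delta T x)).
rewrite mulr_suml; apply: ler_sum => m _.
pose c : R := p ^+ m * (1 - p) ^+ (npairs n - m).
have c0 : 0 <= c by case/andP: p01 => p0 p1; rewrite mulr_ge0 ?exprn_ge0 // subr_ge0.
have gE x : x \in graphs_with n m -> gnp p x = c by rewrite inE => /eqP xm; rewrite /gnp xm.
rewrite [leRHS](eq_big (mem (graphs_with n m)) (fun=> c)); last 2 first.
- by move=> x; rewrite andbT.
- by move=> x /andP [xG _]; exact: gE.
rewrite sumr_const -[leRHS]mulr_natr.
have mN : (m <= npairs n)%N by rewrite -ltnS.
apply: le_trans (ler_wpM2l c0 (slice_chebyshev T0 mN)).
rewrite [leRHS]mulrA ler_wpM2r ?sqr_ge0 // mulr_natr -sumr_const.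
rewrite [leRHS](eq_bigl (fun x => (x \in graphs_with n m) &&
   (T <= ((nwedges x)%:R - meanV R n m) / sigmaV R n m))); last by move=> x; rewrite inE.
rewrite big_mkcondr [leRHS]big_mkcondr; apply: ler_sum => x xG.
rewrite (gE x xG); move: xG; rewrite inE => /eqP xm.
rewrite /canonical_decision xm; case: (Sset delta n m) => /=; first by [].
by case: ifP.
Qed.

End Gnp.

Section PartOne.
Variable (R : realType).
Implicit Types (delta : R).

Lemma iid_prob1 n (mu : graph n -> R) (P : pred (graph n)) :
  iid_prob (k := 1) mu [pred X | P (thead X)] = \sum_(x | P x) mu x.
Proof.
rewrite /iid_prob (reindex (fun x : graph n => [tuple x])) /=; last first.
  exists (fun X : 1.-tuple (graph n) => thead X) => [x _|X _]; first by rewrite theadE.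
  by case/tupleP: X => x t; rewrite theadE (tuple0 t); apply: val_inj.
apply: eq_big => [x|x _]; first by rewrite theadE.
by rewrite big_ord_recl big_ord0 mulr1 tnth0.
Qed.

(** The lower bound on exponential moments is available for [lam <= sqrt n], so larger
values of [L] are capped there. *)
Definition effective_tilt n (L : R) : R := Num.min L (Num.sqrt n%:R).
(** With [sigmaV <= 3 n^(3/2)] the loss in the exponent is
[3 * threshold * lam = rate * lam^2 / 2]. *)
Definition threshold delta n (L : R) : R := rate delta * effective_tilt n L / 6.
Definition risk_constant delta : R :=
  (delta ^+ 2)^-1 + 36 / rate delta ^+ 2 + 2 / rate delta.

(** The three terms of [risk_constant] bound the edge-count test, the wedge test
under the first hypothesis, and the acceptance probability under the second. *)
Lemma worst_error_le delta n (L p : R) (b : R * R) : 0 < delta < 1 / 2 -> (4 <= n)%N ->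
  48 <= delta ^+ 2 * n%:R -> 0 < L -> H0_params delta p ->
  0 <= b.2 -> L * (1 / Num.sqrt n%:R) <= b.2 ->
  worst_error (fun X : 1.-tuple (graph n) => canonical_decision delta (threshold delta n L) (thead X)) p b
   <= risk_constant delta / effective_tilt n L ^+ 2.
Proof.
move=> hd n4 dn L0 hp b0 hb.
have nn0 : 0 < n%:R :> R by rewrite ltr0n (leq_trans _ n4).
have sq0 : 0 < Num.sqrt (n%:R : R) by rewrite sqrtr_gt0.
have sqE : Num.sqrt (n%:R : R) ^+ 2 = n%:R by rewrite sqr_sqrtr // ltW.
set lam := effective_tilt n L.
have l0 : 0 < lam by rewrite lt_min L0.
have lL : lam <= L by rewrite ge_min lexx.
have ln : lam <= Num.sqrt n%:R by rewrite ge_min lexx orbT.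
have l2n : lam ^+ 2 <= n%:R by rewrite -sqE lerXn2r // nnegrE ltW.
have r0 := rate_gt0 hd.
set T := threshold delta n L.
have TE : T = rate delta * lam / 6 by [].
have T0 : 0 < T by rewrite TE divr_gt0 // mulr_gt0.
have l20 : 0 < lam ^+ 2 by rewrite exprn_gt0.
have d0 : 0 < delta by case/andP: hd.
have d20 : 0 < delta ^+ 2 by rewrite exprn_gt0.
rewrite /worst_error ge_max; apply/andP; split; last first.
  rewrite (iid_prob1 _ (fun x => ~~ canonical_decision delta T x)).
  have lb : lam / Num.sqrt n%:R <= 2 * b.2.
    have : lam / Num.sqrt n%:R <= b.2.
      by apply: le_trans hb; rewrite mul1r ler_pM2r ?invr_gt0.
    lra.
  have := @ergm_accept R delta T n b.1 b.2 lam n4 hd dn l0 ln lb TE.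
  rewrite -[\sum_(x | _) _]/(\sum_(x | ~~ canonical_decision delta T x) ergm b.1 b.2 x).
  set S := \sum_(x | _) _ => h.
  rewrite ler_pdivlMr // /risk_constant.
  have h1 : S * lam ^+ 2 <= 2 / rate delta by rewrite ler_pdivlMr //; lra.
  apply: le_trans h1 _; rewrite lerDr addr_ge0 ?invr_ge0 ?divr_ge0 ?sqr_ge0 //.
rewrite (iid_prob1 _ (fun x => canonical_decision delta T x)).
have /andP [hp1 hp2] := hp.
have p01 : 0 <= p <= 1 by apply/andP; split; lra.
have t1 := @gnp_edges_tail R n p p01 delta d0 hp.
have t2 := @gnp_wedge_tail R n p p01 delta T T0.
rewrite (bigID (fun x => Sset delta n (nedges x))) /=.
move: t2; rewrite (eq_bigl (fun x => canonical_decision delta T x && Sset delta n (nedges x))); last first.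
  by move=> x; rewrite andbC.
set S2 := \sum_(x | _ && _) _ => t2.
have -> : \sum_(x : graph n | canonical_decision delta T x && ~~ Sset delta n (nedges x)) gnp p x =
   \sum_(x : graph n | ~~ Sset delta n (nedges x)) gnp p x.
  apply: eq_bigl => x; rewrite /canonical_decision.
  by case: (Sset delta n (nedges x)); rewrite ?andbF.
move: t1; set S1 := \sum_(x | _) _ => t1.
have S10 : 0 <= S1 by apply: sumr_ge0 => x _; exact: gnp_ge0.
have Nn : n%:R <= (npairs n)%:R :> R.
  rewrite npairsE; have : 4 <= n%:R :> R by rewrite (ler_nat _ 4).
  nra.
have h1 : S1 * lam ^+ 2 <= (delta ^+ 2)^-1.
  rewrite -div1r ler_pdivlMr // -mulrA; apply: le_trans t1; rewrite ler_wpM2l //.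
  by rewrite mulrC ler_pM2l //; apply: le_trans Nn.
have h2 : S2 * lam ^+ 2 <= 36 / rate delta ^+ 2.
  rewrite ler_pdivlMr ?exprn_gt0 //.
  have -> : S2 * lam ^+ 2 * rate delta ^+ 2 = 36 * (S2 * T ^+ 2) by rewrite TE; field.
  lra.
rewrite ler_pdivlMr // /risk_constant.
have : 0 <= 2 / rate delta by rewrite divr_ge0 // ltW.
lra.
Qed.

Lemma sup_between (A : set R) (c : R) : 0 <= c -> (forall x, A x -> 0 <= x <= c) ->
  0 <= sup A <= c.
Proof.
move=> c0 Ac; have [->|/set0P [x Ax]] := eqVneq A set0; first by rewrite sup0 lexx.
have ubA : ubound A c by move=> y /Ac /andP [].
apply/andP; split; last by apply: ge_sup => //; exists x.
have /andP [x0 _] := Ac _ Ax; apply: le_trans x0 _.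
by apply: ub_le_sup => //; exists c.
Qed.

Lemma effective_tilt_cvg (L : nat -> R) : L n @[n --> \oo] --> +oo ->
  effective_tilt n (L n) @[n --> \oo] --> +oo.
Proof.
move=> /cvgryPge Loo; apply/cvgryPge => M.
near=> n; rewrite /effective_tilt le_min; apply/andP; split.
  by near: n; exact: Loo.
apply: le_trans (ler_norm M) _; rewrite -sqrtr_sqr ler_wsqrtr //.
by near: n; exact: nbhs_infty_ger.
Unshelve. all: by end_near. Qed.

Lemma ergm_ge0 n (b1 b2 : R) (x : graph n) : 0 <= ergm b1 b2 x.
Proof.
by rewrite divr_ge0 ?expR_ge0 // sumr_ge0 // => y _; rewrite expR_ge0.
Qed.

Lemma iid_prob_ge0 k n (mu : graph n -> R) (A : pred (k.-tuple (graph n))) :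
  (forall x, 0 <= mu x) -> 0 <= iid_prob mu A.
Proof. by move=> mu0; apply: sumr_ge0 => X _; apply: prodr_ge0. Qed.

Lemma strong_regime delta : 0 < delta < 1 / 2 ->
  forall L : nat -> R, (forall n, 0 < L n) -> L n @[n --> \oo] --> +oo ->
  threshold delta n (L n) @[n --> \oo] --> +oo /\
  distinguishes delta (Lambda_strong L)
    (canonical_test delta (fun n => threshold delta n (L n))).
Proof.
move=> hd L L0 Loo; have /cvgryPge lamoo := effective_tilt_cvg Loo.
have r0 := rate_gt0 hd; have /andP [d0 d1] := hd.
have d20 : 0 < delta ^+ 2 by rewrite exprn_gt0.
have c0 : 0 <= risk_constant delta.
  by rewrite !addr_ge0 ?invr_ge0 ?divr_ge0 ?sqr_ge0 ?ler0n // ltW.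
split.
  apply/cvgryPge => M; near=> n; rewrite /threshold ler_pdivlMr // [leRHS]mulrC -ler_pdivrMr //.
  by near: n; exact: lamoo.
apply/cvgrPdist_le => e e0; near=> n.
have n4 : (4 <= n)%N by near: n; exact: nbhs_infty_ge.
have dn : 48 <= delta ^+ 2 * n%:R.
  by rewrite [leRHS]mulrC -ler_pdivrMr //; near: n; exact: nbhs_infty_ger.
have l1 : 1 <= effective_tilt n (L n) by near: n; exact: lamoo.
have l2 : risk_constant delta / e <= effective_tilt n (L n).
  by near: n; exact: lamoo.
set lam := effective_tilt n (L n) in l1 l2.
have l20 : 0 < lam ^+ 2 by rewrite exprn_gt0 // (lt_le_trans _ l1).
have bound : 0 <= risk delta (Lambda_strong L n)
   (canonical_test delta (fun n => threshold delta n (L n)) (n := n))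
     <= risk_constant delta / lam ^+ 2.
  apply: sup_between; first by rewrite divr_ge0 // ltW.
  move=> _ [p hp [b [b0 hb] <-]]; apply/andP; split; last exact: worst_error_le.
  rewrite le_max iid_prob_ge0 // => x; apply: gnp_ge0.
  by case/andP: hp => h1 h2; apply/andP; split; lra.
have /andP [b0 b1] := bound.
rewrite sub0r normrN ger0_norm //; apply: le_trans b1 _.
rewrite ler_pdivrMr //; move: l2; rewrite ler_pdivrMr // => l2.
have : lam <= lam ^+ 2 by nra.
nra.
Unshelve. all: by end_near. Qed.

End PartOne.

(** * Indistinguishability under weak interaction *)

Section SecondMoment.
Variables (R : realType) (I : finType).

(** Expand [sum (a - c v)^2 / v >= 0] at [c = (sum a) / (sum v)]. *)
Lemma sum_sqr_le_weighted (P : pred I) (a v : I -> R) : (forall x, 0 < v x) ->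
  (\sum_(x | P x) a x) ^+ 2 <= (\sum_(x | P x) a x ^+ 2 / v x) * \sum_(x | P x) v x.
Proof.
move=> v0; set S := \sum_(x | P x) a x; set V := \sum_(x | P x) v x.
set Q := \sum_(x | P x) a x ^+ 2 / v x.
have V0 : 0 <= V by apply: sumr_ge0 => x _; exact: ltW.
have [VE|VN] := eqVneq V 0.
  have vE x : P x -> v x = 0 by apply: (psumr_eq0P (fun x _ => ltW (v0 x)) VE).
  rewrite /S big1 ?expr0n ?VE ?mulr0 // => x Px.
  by have := v0 x; rewrite vE // ltxx.
have Vp : 0 < V by rewrite lt0r VN.
pose c := S / V.
have : 0 <= \sum_(x | P x) (a x - c * v x) ^+ 2 / v x.
  by apply: sumr_ge0 => x _; rewrite divr_ge0 ?sqr_ge0 // ltW.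
have -> : \sum_(x | P x) (a x - c * v x) ^+ 2 / v x = Q - 2 * c * S + c ^+ 2 * V.
  rewrite !mulr_sumr -sumrB -big_split; apply: eq_bigr => x _ /=.
  by field; rewrite gt_eqF.
have -> : Q - 2 * c * S + c ^+ 2 * V = Q - S ^+ 2 / V by rewrite /c; field.
by rewrite subr_ge0 ler_pdivrMr.
Qed.

Lemma sum_tuple_prod k (f : I -> R) :
  \sum_(X : k.-tuple I) \prod_(i < k) f (tnth X i) = (\sum_x f x) ^+ k.
Proof.
rewrite -[k in RHS]card_ord -prodr_const bigA_distr_bigA.
rewrite (reindex (fun g : {ffun 'I_k -> I} => [tuple g i | i < k])) /=; last first.
  exists (fun X : k.-tuple I => [ffun i => tnth X i]) => [g _|X _].
    by apply/ffunP => i; rewrite ffunE tnth_mktuple.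
  by apply: eq_from_tnth => i; rewrite tnth_mktuple ffunE.
by apply: eq_bigr => g _; apply: eq_bigr => i _; rewrite tnth_mktuple.
Qed.

End SecondMoment.

Section WeakRegime.
Variable R : realType.

Lemma iid_prob_total k n (mu : graph n -> R) (A : pred (k.-tuple (graph n))) :
  \sum_x mu x = 1 -> iid_prob mu A + iid_prob mu [pred X | ~~ A X] = 1.
Proof.
move=> m1; have := sum_tuple_prod k mu; rewrite m1 expr1n => <-.
by rewrite [RHS](bigID A).
Qed.

(** The second moment of the likelihood ratio tensorises, so if it is bounded an
event of large probability under [mu] keeps a probability bounded below under [nu]
for any fixed number of samples. *)
Lemma iid_prob_sqr_le k n (mu nu : graph n -> R) (A : pred (k.-tuple (graph n))) :
  (forall x, 0 < nu x) ->
  iid_prob mu A ^+ 2 <= (\sum_x mu x ^+ 2 / nu x) ^+ k * iid_prob nu A.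
Proof.
move=> nu0.
have n0 (X : k.-tuple (graph n)) : 0 < \prod_(i < k) nu (tnth X i) by apply: prodr_gt0.
apply: le_trans (sum_sqr_le_weighted A _ n0) _.
rewrite -sum_tuple_prod ler_wpM2r //; first by apply: sumr_ge0 => X _; exact: ltW.
rewrite big_mkcond; apply: ler_sum => X _.
have -> : \prod_(i < k) (mu (tnth X i) ^+ 2 / nu (tnth X i)) =
   (\prod_(i < k) mu (tnth X i)) ^+ 2 / \prod_(i < k) nu (tnth X i).
  by rewrite big_split /= prodfV prodrXl.
by case: ifP => // _; rewrite divr_ge0 ?sqr_ge0 // ltW.
Qed.

Lemma ergm_gt0 n (b1 b2 : R) (x : graph n) : 0 < ergm b1 b2 x.
Proof.
rewrite divr_gt0 ?expR_gt0 // (bigD1 x) //= ltr_wpDr ?expR_gt0 //.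
by apply: sumr_ge0 => y _; exact: expR_ge0.
Qed.

Lemma ergm_total n (b1 b2 : R) : \sum_(x : graph n) ergm b1 b2 x = 1.
Proof.
rewrite -mulr_suml divff // gt_eqF // (bigD1 finset.set0) //= ltr_wpDr ?expR_gt0 //.
by apply: sumr_ge0 => y _; exact: expR_ge0.
Qed.

Lemma gnp_half n (x : graph n) : gnp (1 / 2 : R) x = (ncube R (edge n))^-1.
Proof.
have mN : (nedges x <= npairs n)%N by rewrite -card_edges; exact: max_card.
rewrite /gnp (_ : 1 - 1 / 2 = 1 / 2 :> R); last by field.
rewrite -exprD subnKC // div1r exprVn; congr (_^-1).
by rewrite ncubeE card_edges.
Qed.

(** The value of the edge parameter that cancels the linear terms when the number
of wedges is expanded around density 1/2. *)
Definition balanced_beta1 n (b2 : R) : R := - (b2 * (2 * (n - 2))%:R / (2 * n%:R)).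

Lemma hamiltonian_chaos n (b2 : R) : exists c : R, forall x : graph n,
  hamiltonian (balanced_beta1 n b2) b2 x = b2 / (4 * n%:R) * chaos R (@ladj n) x + c.
Proof.
set N : R := (npairs n)%:R; set d : R := (2 * (n - 2))%:R.
exists (- (b2 / (4 * n%:R) * (N * d))) => x.
have sad (e : edge n) : \sum_f (ladj e f)%:R = d :> R by rewrite -natr_sum ladj_deg.
have s1 : \sum_(e : edge n) \sum_f (ladj e f)%:R * sgn R x e = d * (N - 2 * (nedges x)%:R).
  under eq_bigr => e _ do rewrite -mulr_suml sad.
  rewrite -mulr_sumr; congr (_ * _).
  rewrite (eq_bigr (fun e => 1 - 2 * (e \in x)%:R)); last first.
    by move=> e _; rewrite /sgn; case: (e \in x); rewrite ?expr1 ?expr0 /=; ring.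
  rewrite sumrB sumr_const card_edges -mulr_sumr; congr (_ - _ * _).
  by rewrite /nedges -sum1_card natr_sum [RHS]big_mkcond; apply: eq_bigr => e _; case: (e \in x).
have s2 : \sum_(e : edge n) \sum_f (ladj e f)%:R * sgn R x f = d * (N - 2 * (nedges x)%:R).
  rewrite -s1 exchange_big; apply: eq_bigr => e _; apply: eq_bigr => f _ /=.
  by rewrite ladj_sym.
have s0 : \sum_(e : edge n) \sum_f (ladj e f)%:R = N * d :> R.
  by under eq_bigr => e _ do rewrite sad; rewrite sumr_const card_edges mulr_natl.
have V : 8 * (nwedges x)%:R = N * d - 2 * (d * (N - 2 * (nedges x)%:R)) + chaos R (@ladj n) x.
  have -> : 8 * (nwedges x)%:R = 4 * (2 * (nwedges x)%:R) :> R by ring.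
  have -> : 2 * (d * (N - 2 * (nedges x)%:R)) =
      \sum_(e : edge n) \sum_f (ladj e f)%:R * sgn R x e +
      \sum_(e : edge n) \sum_f (ladj e f)%:R * sgn R x f by rewrite s1 s2; ring.
  rewrite nwedges_pairs -s0 /chaos mulr_sumr -!big_split /= -sumrB -big_split /=.
  apply: eq_bigr => e _; rewrite mulr_sumr -!big_split /= -sumrB -big_split /=.
  apply: eq_bigr => f _.
  by rewrite /sgn; case: (e \in x); case: (f \in x); rewrite ?expr1 ?expr0 /=; ring.
have -> : chaos R (@ladj n) x = 8 * (nwedges x)%:R - N * d + 2 * (d * (N - 2 * (nedges x)%:R)).
  by rewrite V; ring.
rewrite hamiltonianE /balanced_beta1 -/d.
have [n0|n0] := eqVneq (n%:R : R) 0; first by rewrite n0 !mulr0 invr0; ring.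
by field.
Qed.

(** The second moment is the product of the exponential moments of the chaos at [t]
and [-t], where [t^2 N d] is at most of order [1 / L^2]; [L >= 6] meets the
requirement of [chaos_mgf]. *)
Lemma second_moment_le n (L : R) : (2 <= n)%N -> 6 <= L ->
  let b2 := 1 / (L * Num.sqrt n%:R) in
  \sum_(x : graph n) gnp (1 / 2) x ^+ 2 / ergm (balanced_beta1 n b2) b2 x <= expR 1.
Proof.
move=> n2 L6 /=; set b2 : R := 1 / (L * _); set b1 := balanced_beta1 n b2.
have [c hc] := hamiltonian_chaos n b2; rewrite -/b1 in hc.
have nn2 : 2 <= n%:R :> R by rewrite (ler_nat _ 2).
have nn0 : 0 < n%:R :> R by lra.
have sq0 : 0 < Num.sqrt (n%:R : R) by rewrite sqrtr_gt0.
have sqE : Num.sqrt (n%:R : R) ^+ 2 = n%:R by rewrite sqr_sqrtr // ltW.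
set t : R := b2 / (4 * n%:R) in hc.
have tE : t ^+ 2 = 1 / (16 * n%:R ^+ 3 * L ^+ 2).
  rewrite /t /b2; move: sq0 sqE; move: (Num.sqrt _) => q q0 <-; field.
  by rewrite !gt_eqF //; lra.
have T0 : (0 < npairs n)%N by rewrite bin_gt0.
rewrite -card_edges in T0.
have deg (e : edge n) : (#|[set f | ladj e f]%SET| <= 2 * (n - 2))%N by rewrite card_ladj.
have bound (u : R) : u ^+ 2 = t ^+ 2 ->
    \sum_x expR (u * chaos R (@ladj n) x) <= expR (1 / 2) * ncube R (edge n).
  move=> ut; apply: (chaos_mgf (@ladj_sym n) (@ladj_irr n) deg T0).
  rewrite ut tE card_edges npairsE natrM (natrB _ n2).
  move: (n%:R : R) nn2 nn0 => k k2 k0.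
  have -> : 512 * (1 / (16 * k ^+ 3 * L ^+ 2)) * (k * (k - 1) / 2) * (2 * (k - 2)) =
     32 * ((k - 1) * (k - 2)) / (k ^+ 2 * L ^+ 2) by field; rewrite !gt_eqF //; lra.
  have L0 : 0 < L by lra.
  rewrite ler_pdivrMr ?mulr_gt0 ?exprn_gt0 //.
  have h1 : (k - 1) * (k - 2) <= k ^+ 2 by nra.
  have h2 : 32 <= L ^+ 2 by nra.
  have : k ^+ 2 * 32 <= k ^+ 2 * L ^+ 2 by rewrite ler_wpM2l // sqr_ge0.
  lra.
have p1 := bound t erefl; have p2 := bound (- t) (sqrrN t).
have c0 := ncube_gt0 R (edge n).
set Cn := ncube R (edge n) in p1 p2 c0.
have -> : \sum_(x : graph n) gnp (1 / 2) x ^+ 2 / ergm b1 b2 x =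
  (\sum_x expR (- t * chaos R (@ladj n) x)) * (\sum_x expR (t * chaos R (@ladj n) x)) / Cn ^+ 2.
  rewrite mulr_suml mulr_suml; apply: eq_bigr => x _.
  rewrite gnp_half -/Cn /ergm hc.
  have -> : \sum_(y : graph n) expR (hamiltonian b1 b2 y) =
      expR c * \sum_y expR (t * chaos R (@ladj n) y).
    by rewrite mulr_sumr; apply: eq_bigr => y _; rewrite hc expRD mulrC.
  rewrite expRD mulNr expRN exprVn.
  set S := \sum_y _; set E := expR (t * _); set ec := expR c.
  have E0 : E != 0 by rewrite gt_eqF // expR_gt0.
  have ec0 : ec != 0 by rewrite gt_eqF // expR_gt0.
  have S0 : S != 0.
    rewrite gt_eqF // /S (bigD1 x) //= ltr_wpDr ?expR_gt0 //.
    by apply: sumr_ge0 => y _; exact: expR_ge0.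
  by field; rewrite S0 E0 ec0 gt_eqF.
rewrite ler_pdivrMr ?exprn_gt0 //.
have -> : expR 1 * Cn ^+ 2 = (expR (1 / 2) * Cn) * (expR (1 / 2) * Cn).
  have -> : expR 1 = expR (1 / 2) * expR (1 / 2) :> R.
    by rewrite -expRD; congr expR; field.
  ring.
by apply: ler_pM => //; apply: sumr_ge0 => y _; exact: expR_ge0.
Qed.

Lemma worst_error_le1 k n (phi : k.-tuple (graph n) -> bool) (p : R) (b : R * R) :
  0 <= p <= 1 -> worst_error phi p b <= 1.
Proof.
move=> p01; rewrite ge_max; apply/andP; split.
  rewrite -(iid_prob_total [pred X | phi X] (gnp_total n p)) lerDl.
  by apply: iid_prob_ge0 => x; exact: gnp_ge0.
rewrite -(iid_prob_total [pred X | phi X] (ergm_total n b.1 b.2)) lerDr.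
by apply: iid_prob_ge0 => x; exact: ergm_ge0.
Qed.

Lemma weak_regime (delta : R) : 0 < delta < 1 / 2 ->
  forall L : nat -> R, (forall n, 0 < L n) -> L n @[n --> \oo] --> +oo ->
  forall k (phi : test k), ~ distinguishes delta (Lambda_weak L) phi.
Proof.
move=> /andP [d0 d1] L L0 /cvgryPge Loo k phi /cvgrPdist_le dist.
pose C : R := expR 1 ^+ k.
have C1 : 1 <= C by apply: exprn_ege1; apply: le_trans (expR_ge1Dx 1); lra.
have e0 : 0 < (8 * C)^-1 by rewrite invr_gt0; lra.
near \oo => n.
have small : `|0 - risk delta (Lambda_weak L n) (phi n)| <= (8 * C)^-1.
  by near: n; exact: dist.
have n2 : (2 <= n)%N by near: n; exact: nbhs_infty_ge.
have L6 : 6 <= L n by near: n; exact: Loo.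
set ep := risk delta (Lambda_weak L n) (phi n) in small.
pose b2 : R := 1 / (L n * Num.sqrt n%:R); pose b1 := balanced_beta1 n b2.
have worst : worst_error (phi n) (1 / 2) (b1, b2) <= ep.
  apply: ub_le_sup.
    exists 1 => _ [p hp [b _ <-]]; apply: worst_error_le1.
    by case/andP: hp => h1 h2; apply/andP; split; lra.
  exists (1 / 2); first by apply/andP; split; lra.
  exists (b1, b2) => //; split => //=.
  by rewrite divr_ge0 // mulr_ge0 ?sqrtr_ge0 // ltW.
move: worst; rewrite ge_max => /andP [err0 err1].
have CS := @iid_prob_sqr_le k n (gnp (1 / 2 : R)) (ergm b1 b2) [pred X | ~~ phi n X]
   (ergm_gt0 b1 b2).
have total := @iid_prob_total k n (gnp (1 / 2 : R)) [pred X | phi n X] (gnp_total n _).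
have sm := @second_moment_le n (L n) n2 L6; rewrite -/b2 -/b1 in sm.
have sm0 : 0 <= \sum_(x : graph n) gnp (1 / 2) x ^+ 2 / ergm b1 b2 x.
  by apply: sumr_ge0 => x _; rewrite divr_ge0 ?sqr_ge0 // ergm_ge0.
have smk : (\sum_(x : graph n) gnp (1 / 2) x ^+ 2 / ergm b1 b2 x) ^+ k <= C.
  by rewrite lerXn2r // nnegrE expR_ge0.
have nu0 : 0 <= iid_prob (ergm b1 b2) [pred X | ~~ phi n X].
  by apply: iid_prob_ge0 => x; exact: ergm_ge0.
have ep8 : ep <= (8 * C)^-1 by apply: le_trans small; rewrite sub0r normrN ler_norm.
have C8 : (8 * C)^-1 * C = 1 / 8 by field; lra.
have ep18 : (8 * C)^-1 <= 1 / 8 by rewrite -C8; nra.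
move: err0 err1 CS total smk nu0 => /=.
set mu1 := iid_prob _ [pred X | phi n X]; set nu2 := iid_prob (ergm _ _) _.
set mu2 := iid_prob (gnp _) [pred X | ~~ _].
set Q := _ ^+ k => err0 err1 CS total Qk nu0.
have h1 : Q * nu2 <= C * nu2 by rewrite ler_wpM2r.
have h2 : C * nu2 <= C * (8 * C)^-1 by rewrite ler_wpM2l //; lra.
(* otherwise (7/8)^2 <= C * (8 C)^-1 = 1/8 *)
have h3 : 7 / 8 <= mu2 by lra.
nra.
Unshelve. all: by end_near. Qed.

End WeakRegime.

Unset Implicit Arguments.

Theorem theorem7p1 (R : realType) (delta : R) (hdelta : 0 < delta < 1 / 2) :
  (exists T : nat -> R -> R,
     forall L : nat -> R, (forall n, 0 < L n) -> L n @[n --> \oo] --> +oo ->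
       T n (L n) @[n --> \oo] --> +oo /\
       distinguishes delta (Lambda_strong L)
         (canonical_test delta (fun n => T n (L n))))
  /\
  (forall L : nat -> R, (forall n, 0 < L n) -> L n @[n --> \oo] --> +oo ->
     forall k : nat,
       ~ exists phi : test k, distinguishes delta (Lambda_weak L) phi).
Proof.
split; first by exists (threshold delta); exact: strong_regime.
move=> L L0 Loo k [phi]; exact: weak_regime.
Qed.
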